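(* For each $n\in\mathbb N$ let $(X_i)_{i\in[n]}$ be real-valued random variables with CDFs $(F_i)_{i\in[n]}$ (the variables, their CDFs and the neighborhoods below may depend on $n$). Assume that for every $n$: (A) (i) for all $i\in[n]$ the equation $F_i(x)=\tfrac12$ has the unique solution $x=0$; (ii) for all $i\in[n]$, $F_i$ is twice continuously differentiable at $0$; (iii) there exist $\varepsilon,A>0$ (not depending on $n$) such that $|F_i''(y)|\le A$ and $|F_i'(y)|\le A$ for all $|y|\le\varepsilon$ and all $i\in[n]$; (B) $(X_i)_{i\in[n]}$ has dependency neighborhoods $N_i, N_{ij}, N_{ijk}$ as described in the context, with maximal sizes $D_1,D_2,D_3$ (which may depend on $n$). Assume that there are constants $0<c<C<\infty$ such that for all $n\in\mathbb N$ $$c<\sigma_n^2<C,\qquad c<\theta_n<C,\qquad \max\{D_1,D_2,D_3\}\le C\, n^{1/4}.$$ Then, with $M_n$ the sample median and $Z\sim N(0,1)$, $$d_{\mathrm{KS}}\left(\frac{\theta_n\sqrt n}{\sigma_n}M_n\,,\,Z\right)\lesssim D_1\sqrt{\log n+D_1}\cdot\sqrt{\frac{\log n}{n}}+\frac{\max\{D_1,D_2,D_3\}^2}{\sqrt n},$$ i.e. there is a constant $K$ depending only on $\varepsilon,A,c,C$ such that for all $n\in\mathbb N$ the left-hand side is at most $K$ times the right-hand side.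
   Context: Notation: $[n]=\{1,\dots,n\}$. $d_{\mathrm{KS}}(W,Z)=\sup_{x\in\mathbb R}|\mathbb P(W\le x)-\mathbb P(Z\le x)|$. Sample median: $M_n:=\sup\{x\in\mathbb R : |\{i\in[n] : X_i\le x\}|\le\lfloor n/2\rfloor\}$. $\theta_n:=\frac1n\sum_{j=1}^nF_j'(0)$ and $\sigma_n^2:=\frac1n\operatorname{Var}\left(\sum_{i=1}^n\left(\mathbf 1_{X_i\le 0}-F_i(0)\right)\right)$, with $\sigma_n>0$. Dependency neighborhoods: (1) for every $i\in[n]$ there is $N_i\subseteq[n]$ with $i\in N_i$ such that $X_i$ is independent of $(X_l)_{l\in N_i^c}$; (2) for every $i\in[n]$ and $j\in N_i$ there is $N_{ij}\subseteq[n]$ with $N_i\subseteq N_{ij}$ such that $(X_i,X_j)$ is independent of $(X_k)_{k\in N_{ij}^c}$; (3) for every $i\in[n]$, $j\in N_i$, $k\in N_{ij}$ there is $N_{ijk}\subseteq[n]$ with $N_{ij}\subseteq N_{ijk}$ such that $(X_i,X_j,X_k)$ is independent of $(X_s)_{s\in N_{ijk}^c}$. The parameters are $D_1:=\max_i|N_i|$, $D_2:=\max_{i,j}|N_{ij}|$, $D_3:=\max_{i,j,k}|N_{ijk}|$. *)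

(* Defs.v *)
From mathcomp Require Export all_boot all_order all_algebra.
From mathcomp Require Export all_classical all_reals all_analysis.

Set Implicit Arguments.
Unset Strict Implicit.
Unset Printing Implicit Defensive.

Export Order.TTheory GRing.Theory Num.Theory.
Export numFieldNormedType.Exports.

Local Open Scope classical_set_scope.
Local Open Scope ring_scope.

(* Real-valued version of the library's [cdf], which takes values in \bar R. *)
Definition rcdf d (T : measurableType d) (R : realType) (P : probability T R)
    (X : {RV P >-> R}) (x : R) : R := fine (cdf X x).

(* Stated for plain functions so that it applies to the sample median without
   packaging its measurability; the supremum is that of a nonempty subset
   of [0, 1]. *)
Definition dKS d (T : measurableType d) d' (U : measurableType d')
    (R : realType) (P : probability T R) (Q : probability U R)
    (W : T -> R) (Z : U -> R) : R :=
  sup [set `|fine (P [set t | W t <= x]) - fine (Q [set u | Z u <= x])|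
      | x in [set: R]].

Definition standard_normal d (U : measurableType d) (R : realType)
    (Q : probability U R) (Z : {RV Q >-> R}) : Prop :=
  forall B : set R, measurable B -> distribution Q Z B = normal_prob 0 1 B.

Definition sample_median (R : realType) n (x : 'I_n -> R) : R :=
  sup [set y : R | (#|[set i | (x i <= y)%R]%SET| <= n./2)%N].

Section sample.
Context d (T : measurableType d) (R : realType) (P : probability T R).
Context (n : nat) (X : 'I_n -> {RV P >-> R}).

Definition theta : R := n%:R^-1 * \sum_(j < n) (rcdf (X j))^`()%classic 0.

Definition sigma2 : R :=
  n%:R^-1 * fine 'V_P[(fun t : T =>
    \sum_(i < n) (\1_[set s | X i s <= 0] t - rcdf (X i) 0))].

Definition sigma_alg (S : {set 'I_n}) : set (set T) :=
  <<s \bigcup_(i in [set` S]) preimage_set_system setT (X i) measurable >>.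

Definition indep_subfamilies (S S' : {set 'I_n}) : Prop :=
  forall A B, sigma_alg S A -> sigma_alg S' B ->
    P (A `&` B) = (P A * P B)%E.

(* The values of [N2 i j] with j \notin N1 i, and of [N3 i j k] with
   j \notin N1 i or k \notin N2 i j, are irrelevant here and in D2, D3. *)
Definition dependency_neighborhoods (N1 : 'I_n -> {set 'I_n})
    (N2 : 'I_n -> 'I_n -> {set 'I_n})
    (N3 : 'I_n -> 'I_n -> 'I_n -> {set 'I_n}) : Prop :=
  [/\ (forall i, i \in N1 i /\ indep_subfamilies [set i]%SET (~: N1 i)%SET),
      (forall i j, j \in N1 i ->
         N1 i \subset N2 i j /\
         indep_subfamilies [set i; j]%SET (~: N2 i j)%SET)
    & (forall i j k, j \in N1 i -> k \in N2 i j ->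
         N2 i j \subset N3 i j k /\
         indep_subfamilies [set i; j; k]%SET (~: N3 i j k)%SET)].

End sample.

Definition D1 n (N1 : 'I_n -> {set 'I_n}) : nat := \max_(i < n) #|N1 i|.

Definition D2 n (N1 : 'I_n -> {set 'I_n})
    (N2 : 'I_n -> 'I_n -> {set 'I_n}) : nat :=
  \max_(i < n) \max_(j in N1 i) #|N2 i j|.

Definition D3 n (N1 : 'I_n -> {set 'I_n})
    (N2 : 'I_n -> 'I_n -> {set 'I_n})
    (N3 : 'I_n -> 'I_n -> 'I_n -> {set 'I_n}) : nat :=
  \max_(i < n) \max_(j in N1 i) \max_(k in N2 i j) #|N3 i j k|.

Definition Dmax n (N1 : 'I_n -> {set 'I_n})
    (N2 : 'I_n -> 'I_n -> {set 'I_n})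
    (N3 : 'I_n -> 'I_n -> 'I_n -> {set 'I_n}) : nat :=
  maxn (D1 N1) (maxn (D2 N1 N2) (D3 N1 N2 N3)).

Definition twice_cont_diff_at (R : realType) (f : R -> R) (x : R) : Prop :=
  [/\ (\forall y \near x, derivable f y 1),
      (\forall y \near x, derivable f^`()%classic y 1)
    & {for x, continuous f^`(2)%classic}].

(* Derivatives are total in the library, so bounds on f' and f'' have to
   assert their existence explicitly. *)
Definition derivs_bounded_on (R : realType) (eps A : R) (f : R -> R) : Prop :=
  forall y, `|y| <= eps ->
    [/\ derivable f y 1, derivable f^`()%classic y 1,
        `|f^`(2)%classic y| <= A & `|f^`()%classic y| <= A].

Definition cdf_regularity (R : realType) (eps A : R) (F : R -> R) : Prop :=
  [/\ (forall x, F x = 2^-1 <-> x = 0),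
      twice_cont_diff_at F 0
    & derivs_bounded_on eps A F].

(* Main.v *)
From HB Require Import structures.
Require Import Defs.
From mathcomp Require Import measurable_realfun ring lra.

(* Since M_n <= y iff more than n/2 of the X_i are <= y, the distribution
   function of M_n at y is a tail probability of the sum of the indicators
   1_{X_i <= y}. For each fixed y these indicators inherit the dependency
   neighborhoods of the X_i, so a Berry-Esseen bound applies at y directly and
   gives an error D^2 / sqrt n, where D = max(D1, D2, D3). Centering and
   variance at y are compared with those at 0: they change by O(y^2) and
   O(D |y|), which costs another O(D / sqrt n) because (1 + x^2) phi(x) is
   bounded. This works for |x| <= kap n^{1/4} / D; beyond that, monotonicity
   and 1 - Phi(u) <= 2 / u^2 suffice.

   The pattern {i : X_i <= y} takes finitely many values, so the Berry-Esseen
   bound is proved on a finite probability space, by Stein's method with a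
   piecewise linear test function of width al. All summands being at most b,
   the smoothing error is controlled by P(z - D b <= W <= z + al + D b), hence
   by the Kolmogorov distance itself, and with al of order D^2 / sqrt n that
   distance reappears with a factor 1/2. *)

Set Implicit Arguments.
Unset Strict Implicit.
Unset Printing Implicit Defensive.

Local Open Scope classical_set_scope.
Local Open Scope ring_scope.

(** * The standard normal distribution *)

Section gaussian.
Context {R : realType}.
Local Notation mu := (@lebesgue_measure R).

Definition gauss_pdf (x : R) : R := normal_pdf 0 1 x.
Definition gauss_cdf (x : R) : R := (\int[mu]_(t in `]-oo, x]) gauss_pdf t)%R.

Lemma gauss_pdfE (x : R) :
  gauss_pdf x = normal_peak 1 * expR (- (x ^+ 2 / 2)).
Proof.
rewrite /gauss_pdf normal_pdfE ?oner_neq0// /normal_fun.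
by rewrite subr0 expr1n mulNr.
Qed.

Lemma normal_peak1_le1 : normal_peak (1 : R) <= 1.
Proof.
rewrite /normal_peak invf_le1; last first.
  by rewrite sqrtr_gt0 expr1n mul1r mulrn_wgt0// pi_gt0.
rewrite -[leLHS]sqrtr1 ler_wsqrtr// expr1n mul1r mulr2n.
by have := @pi_ge2 R; lra.
Qed.

Lemma gauss_pdf_gt0 (x : R) : 0 < gauss_pdf x.
Proof. by rewrite gauss_pdfE mulr_gt0 ?expR_gt0// normal_peak_gt0// oner_neq0. Qed.

Lemma gauss_pdfN (x : R) : gauss_pdf (- x) = gauss_pdf x.
Proof. by rewrite !gauss_pdfE sqrrN. Qed.

(** From [expR u >= 1 + u]. A rational bound on the density keeps the later tail and distance
    estimates polynomial. *)
Lemma gauss_pdf_le (x : R) : gauss_pdf x <= (1 + x ^+ 2 / 2)^-1.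
Proof.
rewrite gauss_pdfE -[leRHS]mul1r; apply: ler_pM => //.
- by rewrite ltW// normal_peak_gt0// oner_neq0.
- exact: normal_peak1_le1.
rewrite expRN lef_pV2 ?posrE ?expR_gt0 ?expR_ge1Dx//.
by have := sqr_ge0 x; lra.
Qed.

Lemma gauss_pdf_le1 (x : R) : gauss_pdf x <= 1.
Proof.
apply: (le_trans (gauss_pdf_le x)); rewrite invf_le1; have := sqr_ge0 x; lra.
Qed.

Lemma is_derive_gauss_pdf (x : R) : is_derive x 1 gauss_pdf (- x * gauss_pdf x).
Proof.
have -> : gauss_pdf = (fun x : R => normal_peak 1 * expR (- (x ^+ 2 / 2))).
  by apply/funext => y; rewrite gauss_pdfE.
apply: is_derive_eq.
by rewrite /GRing.scale/=; field.
Qed.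

Lemma continuous_gauss_pdf : continuous gauss_pdf.
Proof. by apply: continuous_normal_pdf; exact: oner_neq0. Qed.

Lemma integrable_gauss_pdf (D : set R) : measurable D ->
  mu.-integrable D (EFin \o gauss_pdf).
Proof.
by move=> mD; apply: (integrableS measurableT) => //; exact: integrable_normal_pdf.
Qed.

Lemma is_derive_gauss_cdf (x : R) : is_derive x 1 gauss_cdf (gauss_pdf x).
Proof.
have [||||dF F'] := @continuous_FTC1 R gauss_pdf -oo%O x (x + 1).
- by rewrite ltrDl.
- by apply: integrable_gauss_pdf.
- by rewrite ltNyr.
- exact: continuous_gauss_pdf.
by apply: DeriveDef; [exact: dF|rewrite -derive1E; exact: F'].
Qed.

Lemma gauss_cdf_normal_prob (x : R) :
  gauss_cdf x = fine (normal_prob 0 1 `]-oo, x] : \bar R).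
Proof. by []. Qed.

Lemma gauss_cdf_ge0 (x : R) : 0 <= gauss_cdf x.
Proof. by rewrite gauss_cdf_normal_prob fine_ge0. Qed.

Lemma gauss_cdf_le1 (x : R) : gauss_cdf x <= 1.
Proof.
rewrite gauss_cdf_normal_prob -lee_fin fineK ?fin_num_measure//.
exact: probability_le1.
Qed.

(** The identity, as a random variable under [normal_prob 0 1], has [gauss_cdf] as its distribution
    function, so both limits at infinity come from the general facts on [cdf]. *)
Let gauss_id : measurableTypeR R -> R := idfun.

#[local] HB.instance Definition _ :=
  @isMeasurableFun.Build _ _ _ _ gauss_id (@measurable_id _ _ setT).

Lemma cvg_gauss_cdfy : gauss_cdf x @[x --> +oo] --> (1 : R).
Proof.
have := @cvg_cdfy1 _ _ R (@normal_prob R 0 1)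
  (gauss_id : {RV (@normal_prob R 0 1) >-> R}).
by move/fine_cvg.
Qed.

Lemma cvg_gauss_cdfNy : gauss_cdf x @[x --> -oo] --> (0 : R).
Proof.
have := @cvg_cdfNy0 _ _ R (@normal_prob R 0 1)
  (gauss_id : {RV (@normal_prob R 0 1) >-> R}).
by move/fine_cvg.
Qed.

Lemma le_of_derive (f g f' g' : R -> R) (a b : R) :
  (forall x : R, is_derive x 1 f (f' x)) -> (forall x : R, is_derive x 1 g (g' x)) ->
  (forall x, a < x < b -> f' x <= g' x) -> a <= b -> f b - f a <= g b - g a.
Proof.
move=> df dg fg; rewrite le_eqVlt => /predU1P[->|ab]; first by rewrite !subrr.
have dh (x : R) : is_derive x 1 (g - f) (g' x - f' x) by apply: is_deriveB.
have [|c] := @MVT R (g - f) (fun x => g' x - f' x) a b ab (fun x _ => dh x).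
  apply: continuous_subspaceT => x; apply: differentiable_continuous.
  by apply/derivable1_diffP; case: (dh x).
rewrite in_itv/= => /fg cfg; rewrite -subr_ge0 => E.
suff : 0 <= (g - f) b - (g - f) a.
  by rewrite -[(g - f) b]/(g b - f b) -[(g - f) a]/(g a - f a); lra.
by rewrite E mulr_ge0// subr_ge0// ltW.
Qed.

Lemma gauss_cdf_le (a b : R) : a <= b -> gauss_cdf a <= gauss_cdf b.
Proof.
move=> ab; have := @le_of_derive (cst 0) gauss_cdf (cst 0) gauss_pdf a b
  (fun x => is_derive_cst _ _ _) is_derive_gauss_cdf.
rewrite /cst subrr subr_ge0; apply => // x _; exact/ltW/gauss_pdf_gt0.
Qed.

Lemma gauss_cdf_lip (a b : R) : a <= b -> gauss_cdf b - gauss_cdf a <= b - a.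
Proof.
move=> ab; apply: (le_of_derive is_derive_gauss_cdf (fun x => is_derive_id x 1)) => // x _.
exact: gauss_pdf_le1.
Qed.

(** The function [gauss_cdf (- t) + gauss_cdf t] has derivative 0, hence is constant, and it tends
    to 1. *)
Lemma gauss_cdfN (x : R) : gauss_cdf (- x) = 1 - gauss_cdf x.
Proof.
have dN (y : R) : is_derive y 1 (fun t => gauss_cdf (- t)) (- gauss_pdf y).
  have h := is_derive1_comp (is_derive_gauss_cdf (- y)) (is_deriveN (is_derive_id y 1)).
  by apply: is_derive_eq h _; rewrite gauss_pdfN mulrN1.
have dS (y : R) : is_derive y 1 (fun t => gauss_cdf (- t) + gauss_cdf t) 0.
  by have := is_deriveD (dN y) (is_derive_gauss_cdf y); rewrite addNr.
have S0 : (fun t => gauss_cdf (- t) + gauss_cdf t) =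
          cst (gauss_cdf (- x) + gauss_cdf x).
  by apply/funext => y; rewrite (is_derive_0_is_cst y x dS).
have : (fun t => gauss_cdf (- t) + gauss_cdf t) y @[y --> +oo] --> (0 + 1 : R).
  apply: cvgD cvg_gauss_cdfy; apply: cvg_comp cvg_gauss_cdfNy.
  by apply/cvgNrNy.
rewrite S0 add0r => /cvg_lim; rewrite lim_cst// => /(_ (@Rhausdorff R)) <-.
by ring.
Qed.

(** For [x > w] the density at [x] is at most [x / w] times itself, which is the derivative of
    [- gauss_pdf x / w]. Comparing increments on [[w, v]] and letting [v] go to infinity gives the
    bound. *)
Lemma mills_ratio (w : R) : 0 < w -> w * (1 - gauss_cdf w) <= gauss_pdf w.
Proof.
move=> w0; rewrite mulrC -ler_pdivlMr//.
suff h v : w <= v -> gauss_cdf v <= gauss_cdf w + gauss_pdf w / w.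
  rewrite lerBlDl; apply: (cvgr_to_le cvg_gauss_cdfy).
  by near=> v; apply: h; near: v; apply: nbhs_pinfty_ge; exact: num_real.
move=> wv; rewrite -lerBlDl.
have dg (x : R) : is_derive x 1 (fun t => - w^-1 * gauss_pdf t) (- w^-1 * (- x * gauss_pdf x)).
  by have := is_deriveZ (- w^-1) (is_derive_gauss_pdf x).
apply: (le_trans (le_of_derive is_derive_gauss_cdf dg _ wv)) => [x /andP[wx _]|].
  have -> : - w^-1 * (- x * gauss_pdf x) = (x / w) * gauss_pdf x by ring.
  by rewrite ler_peMl ?(ltW (gauss_pdf_gt0 _))// ler_pdivlMr// mul1r ltW.
have := gauss_pdf_gt0 v; have : 0 < w^-1 by rewrite invr_gt0.
by nra.
Unshelve. all: by end_near. Qed.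

Lemma gauss_tail (u : R) : 0 < u -> u ^+ 2 * (1 - gauss_cdf u) <= 2.
Proof.
move=> u0; have := mills_ratio u0; have := gauss_pdf_le u.
have p : 0 < 1 + u ^+ 2 / 2 by have := sqr_ge0 u; lra.
rewrite -[X in _ <= X]mul1r ler_pdivlMr//.
have := gauss_pdf_gt0 u; set g := gauss_pdf u; set F := 1 - gauss_cdf u.
move=> g0 h1 h2.
have h3 : u ^+ 2 * F <= u * g by rewrite expr2 -mulrA ler_wpM2l// ltW.
have : 0 <= g * (u - 1) ^+ 2 by rewrite mulr_ge0 ?sqr_ge0 ?ltW.
by nra.
Qed.

(** Points between [x] and [a] have modulus comparable to that of [x], so the density there decays
    like [1 / (1 + x ^+ 2)]. A shift that grows like [1 + x ^+ 2] thus costs only a uniform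
    error. *)
Lemma gauss_cdf_dist (x a : R) : `|a - x| <= `|x| / 2 + 1 ->
  `|gauss_cdf a - gauss_cdf x| * (1 + x ^+ 2) <= 16 * `|a - x|.
Proof.
have H (s t : R) : s < t -> exists2 c, s < c < t &
    gauss_cdf t - gauss_cdf s = gauss_pdf c * (t - s).
  move=> st; have [|c] := @MVT R _ _ _ _ st (fun x _ => is_derive_gauss_cdf x).
    apply: continuous_subspaceT => y; apply: differentiable_continuous.
    by apply/derivable1_diffP; case: (is_derive_gauss_cdf y).
  by rewrite in_itv; exists c.
have K (c e : R) : `|c - x| <= `|x| / 2 + 1 -> 0 <= e ->
    gauss_pdf c * e * (1 + x ^+ 2) <= 16 * e.
  move=> cx e0; have p : 0 < 1 + c ^+ 2 / 2 by have := sqr_ge0 c; lra.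
  have := gauss_pdf_le c; rewrite -[X in _ <= X]mul1r ler_pdivlMr//.
  have := gauss_pdf_gt0 c; set g := gauss_pdf c => g0 gc.
  rewrite mulrAC ler_wpM2r//.
  have xc : `|x| <= 2 * `|c| + 2.
    have := ler_distD c x 0; rewrite !subr0 (distrC x) => ?; lra.
  (* The constant 16: since 2|c| <= 1 + c^2, one has 1 + (2|c| + 2)^2 <= 9 + 8 c^2 <= 16 (1 + c^2 /
     2). *)
  have : x ^+ 2 <= (2 * `|c| + 2) ^+ 2.
    by rewrite -(real_normK (num_real x)) ler_pXn2r// nnegrE; have := normr_ge0 c; lra.
  have : `|c| ^+ 2 = c ^+ 2 by rewrite real_normK// num_real.
  have : 0 <= g * (`|c| - 1) ^+ 2 by rewrite mulr_ge0 ?sqr_ge0 ?ltW.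
  by nra.
move=> ax; have [xa|ax'|->] := ltgtP x a; last by rewrite !subrr normr0 mul0r mulr0.
- have [c cxa ->] := H _ _ xa.
  rewrite normrM (gtr0_norm (gauss_pdf_gt0 c)); apply: K => //.
  rewrite ltW// (lt_le_trans _ ax)// !ger0_norm; lra.
- have [c cxa E] := H _ _ ax'.
  rewrite (distrC a) (distrC (gauss_cdf a)) E; rewrite (distrC a) in ax.
  rewrite normrM (gtr0_norm (gauss_pdf_gt0 c)); apply: K => //.
  rewrite distrC.
  rewrite ltW// (lt_le_trans _ ax)// !ger0_norm; lra.
Qed.

End gaussian.

(** * Stein's equation *)

Section stein_solution.
Context {R : realType}.
Local Notation mu := (@lebesgue_measure R).
Implicit Types (h : R -> R) (w : R).

(** [H w] is the integral of [h * gauss_pdf] up to [w], and [m] is the integral over the whole line,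
    the Gaussian mean of [h]. The bounds compare integrands using [0 <= h <= 1]. *)
Lemma gauss_primitive h : continuous h -> (forall x, 0 <= h x <= 1) ->
  exists (H : R -> R) (m : R),
    [/\ forall w : R, is_derive w 1 H (h w * gauss_pdf w),
        forall w, 0 <= H w <= gauss_cdf w,
        forall w, 0 <= m - H w <= 1 - gauss_cdf w,
        forall w, (forall x, x <= w -> h x = 1) -> H w = gauss_cdf w
      & forall w, (forall x, w < x -> h x = 0) -> m = H w].
Proof.
move=> ch h01; pose g x := h x * gauss_pdf x.
have cg : continuous g by move=> x; apply: cvgM; [exact: ch|exact: continuous_gauss_pdf].
have g0 x : 0 <= g x by rewrite mulr_ge0 ?(ltW (gauss_pdf_gt0 _))//; have /andP[] := h01 x.
have gphi x : g x <= gauss_pdf x.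
  by rewrite ler_piMl ?(ltW (gauss_pdf_gt0 _))//; have /andP[] := h01 x.
have ig (D : set R) : measurable D -> mu.-integrable D (EFin \o g).
  move=> mD; apply: le_integrable (integrable_gauss_pdf mD) => //.
    apply/measurable_EFinP; apply: measurable_funTS.
    by apply: continuous_measurable_fun.
  by move=> x _; rewrite /= lee_fin !ger0_norm// (ltW (gauss_pdf_gt0 _)).
pose H w := (\int[mu]_(t in `]-oo, w]) g t)%R.
pose m := (\int[mu]_(t in `]-oo, +oo[) g t)%R.
have mH w : m - H w = (\int[mu]_(t in `]w, +oo[) g t)%R.
  by rewrite /m /H Rintegral_itvB//; exact: ig.
have phiT w : 1 - gauss_cdf w = (\int[mu]_(t in `]w, +oo[) gauss_pdf t)%R.
  rewrite -(@Rintegral_itvB _ _ -oo%O)//; last exact: integrable_gauss_pdf.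
  congr (_ - _); rewrite /Rintegral set_itvNyy.
  by have /= -> := @integral_normal_pdf R 0 1.
exists H, m; split.
- move=> w; have [||||dF F'] := @continuous_FTC1 R g -oo%O w (w + 1).
  + by rewrite ltrDl.
  + exact: ig.
  + by rewrite ltNyr.
  + exact: cg.
  by apply: DeriveDef; [exact: dF|rewrite -derive1E; exact: F'].
- move=> w; rewrite Rintegral_ge0//=.
  by apply: le_Rintegral => //; [exact: ig|exact: integrable_gauss_pdf].
- move=> w; rewrite mH phiT Rintegral_ge0//=.
  by apply: le_Rintegral => //; [exact: ig|exact: integrable_gauss_pdf].
- move=> w h1; apply: eq_Rintegral => x; rewrite inE/= in_itv/= => xw.
  by rewrite /g h1// mul1r.
- move=> w h0; apply/eqP; rewrite -subr_eq0 mH; apply/eqP.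
  rewrite (@eq_Rintegral _ _ _ _ _ (cst 0)) ?Rintegral_cst ?mul0r//= => x.
  by rewrite inE/= in_itv/= andbT => xw; rewrite /g h0// mul0r.
Qed.

(** The solution is [(H - m * gauss_cdf) / gauss_pdf]. The Mills ratio bounds [w * f w] by 1, and
    the equation itself then bounds the derivative by 2. *)
Lemma stein_equation h : continuous h -> (forall x, 0 <= h x <= 1) ->
  exists (f : R -> R) (m : R),
    [/\ forall w : R, is_derive w 1 f (w * f w + (h w - m)),
        forall w, `|f w| <= 5,
        forall w, `|w * f w + (h w - m)| <= 2,
        forall w, (forall x, x <= w -> h x = 1) -> gauss_cdf w <= m
      & forall w, (forall x, w < x -> h x = 0) -> m <= gauss_cdf w].
Proof.
move=> ch h01; have [H [m [dH H0 Hm H1 mH]]] := gauss_primitive ch h01.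
pose f w := (H w - m * gauss_cdf w) / gauss_pdf w.
have p0 w := @gauss_pdf_gt0 R w.
have m01 : 0 <= m <= 1.
  by have := H0 0; have := Hm 0; have := gauss_cdf_le1 (0 : R); lra.
(* With F = [gauss_cdf w], the left side is H (1 - F) - (m - H) F, a difference of two numbers in
   [0, F (1 - F)]. *)
have GP w : `|H w - m * gauss_cdf w| <= gauss_cdf w * (1 - gauss_cdf w).
  have := H0 w; have := Hm w; have := gauss_cdf_le1 w; have := gauss_cdf_ge0 w.
  by rewrite ler_norml; move=> ? ? ? ?; apply/andP; split; nra.
have wf w : `|w * f w| <= 1.
  rewrite mulrA normrM normfV (gtr0_norm (p0 w)) ler_pdivrMr// mul1r normrM.
  have [w0|w0|->] := ltgtP w 0; last by rewrite normr0 mul0r ltW.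
  - have w0' : 0 < - w by lra.
    have := mills_ratio w0'; rewrite gauss_cdfN gauss_pdfN subKr ltr0_norm//.
    apply: le_trans; apply: ler_wpM2l; first exact: ltW.
    apply: (le_trans (GP w)); have := gauss_cdf_le1 w; have := gauss_cdf_ge0 w.
    by nra.
  - have := mills_ratio w0; rewrite gtr0_norm//.
    apply: le_trans; apply: ler_wpM2l; first exact: ltW.
    apply: (le_trans (GP w)); have := gauss_cdf_le1 w; have := gauss_cdf_ge0 w.
    by nra.
exists f, m; split.
- move=> w; have dV : is_derive w 1 (fun x : R => (gauss_pdf x)^-1)
      (- (gauss_pdf w) ^- 2 *: (- w * gauss_pdf w)).
    by apply: is_deriveV; [rewrite gt_eqF|exact: is_derive_gauss_pdf].
  have dC : is_derive w 1 (fun x : R => m * gauss_cdf x) (m *: gauss_pdf w).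
    exact: is_deriveZ (is_derive_gauss_cdf w).
  have dD : is_derive w 1 (fun x : R => H x - m * gauss_cdf x)
      (h w * gauss_pdf w - m *: gauss_pdf w).
    exact: is_deriveB.
  apply: (is_derive_eq (is_deriveM dD dV)); rewrite /GRing.scale/= /f.
  by field; rewrite gt_eqF.
(* For [|w| >= 1] the bound on [w * f w] suffices; otherwise the numerator is at most 1/4 and the
   density at least 1/20, whence 5. *)
- move=> w; have [w1|w1] := lerP 1 `|w|.
    have := wf w; rewrite normrM; have := normr_ge0 (f w); nra.
  rewrite normrM normfV (gtr0_norm (p0 w)) ler_pdivrMr//.
  have : `|H w - m * gauss_cdf w| <= 4^-1.
    apply: (le_trans (GP w)).
    by have := sqr_ge0 (gauss_cdf w - 2^-1); rewrite expr2; lra.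
  suff : 20^-1 <= gauss_pdf w by lra.
  rewrite gauss_pdfE.
  have e1 : 2^-1 <= expR (- (w ^+ 2 / 2)).
    apply: le_trans (expR_ge1Dx _).
    have : w ^+ 2 <= 1 by rewrite -real_normK ?num_real// exprn_ile1// ltW.
    by lra.
  have e2 : 10^-1 <= normal_peak (1 : R).
    rewrite /normal_peak lef_pV2 ?posrE// ?sqrtr_gt0 ?mulrn_wgt0 ?mulr_gt0 ?pi_gt0//.
    rewrite -[leRHS]ger0_norm// -sqrtr_sqr ler_wsqrtr// expr1n mul1r.
    by have := @pihalf_lt2 R; lra.
  by nra.
- move=> w; apply: (le_trans (ler_normD _ _)).
  have : `|h w - m| <= 1 by have := h01 w; rewrite ler_norml; lra.
  by have := wf w; lra.
- by move=> w /H1 E; have := Hm w; rewrite E; lra.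
- by move=> w /mH ->; have /andP[] := H0 w.
Qed.

(** * Piecewise linear smoothing of half-line indicators *)

Definition ramp (z al w : R) : R := Num.max 0 (Num.min 1 (1 - (w - z) / al)).

Lemma ramp01 z al w : 0 <= ramp z al w <= 1.
Proof. by rewrite /ramp le_max lexx/= ge_max ler01 ge_min lexx. Qed.

Lemma ramp1 z al w : 0 < al -> w <= z -> ramp z al w = 1.
Proof.
move=> al0 wz; have : (w - z) / al <= 0 by rewrite ler_pdivrMr// mul0r subr_le0.
by move=> ?; rewrite /ramp min_l ?max_r//; lra.
Qed.

Lemma ramp0 z al w : 0 < al -> z + al <= w -> ramp z al w = 0.
Proof.
move=> al0 wz; have : 1 <= (w - z) / al by rewrite ler_pdivlMr// mul1r lerBrDl.
by move=> ?; rewrite /ramp max_l// ge_min; apply/orP; right; lra.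
Qed.

Lemma ramp_lip z al v w : 0 < al -> `|ramp z al v - ramp z al w| <= `|v - w| / al.
Proof.
move=> al0; have -> : `|v - w| / al = `|(v - z) / al - (w - z) / al|.
  rewrite -mulrBl normrM normfV (gtr0_norm al0); congr (`|_| / _); ring.
rewrite /ramp; set a := (v - z) / al; set b := (w - z) / al.
rewrite ler_norml; have := ler_norm (a - b); have := ler_norm (b - a).
rewrite (distrC b a) /Num.max /Num.min.
by do 4 case: ifP; move=> *; lra.
Qed.

Lemma ramp_continuous z al : 0 < al -> continuous (ramp z al).
Proof.
move=> al0 w; apply/cvgrPdist_lt => e e0; near=> v.
apply: (le_lt_trans (ramp_lip z w v al0)); rewrite ltr_pdivrMr//.
by near: v; apply: cvgr_dist_lt; rewrite ?mulr_gt0//; exact: cvg_id.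
Unshelve. all: by end_near. Qed.

(* The modulus of [df] is the usual one away from the ramp; on the ramp it loses
   a factor 1/al, but only where [w] is within [be] of [[z, z + al]]. *)
Lemma stein_ramp (z al : R) : 0 < al ->
  exists (f df : R -> R) (m : R),
    [/\ forall w : R, is_derive w 1 f (df w),
        forall w : R, df w - w * f w = ramp z al w - m,
        forall w : R, `|df w| <= 2,
        forall be w v : R, 0 <= be -> `|v - w| <= be ->
          `|df v - df w| <= be * (5 + 2 * `|w|)
             + be / al * (z - be <= w <= z + al + be)%R%:R
      & gauss_cdf z <= m <= gauss_cdf (z + al)].
Proof.
move=> al0.
have [f [m [df f5 df2 zm mz]]] := stein_equation (@ramp_continuous z al al0) (@ramp01 z al).
exists f, (fun w => w * f w + (ramp z al w - m)), m; split => //.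
- by move=> w; ring.
- move=> be w v be0 vw.
  have flip (a b : R) : a <= b -> `|f b - f a| <= 2 * (b - a).
    rewrite le_eqVlt => /predU1P[->|ab]; first by rewrite !subrr normr0 mulr0.
    have [|c _ ->] := @MVT R f _ _ _ ab (fun x _ => df x).
      apply: continuous_subspaceT => y; apply: differentiable_continuous.
      by apply/derivable1_diffP; case: (df y).
    by rewrite normrM (gtr0_norm (_ : 0 < b - a)) ?subr_gt0// ler_pM2r ?subr_gt0.
  have flip' : `|f v - f w| <= 2 * be.
    have [ab|/ltW ab] := lerP w v.
      by apply: (le_trans (flip _ _ ab)); move: vw; rewrite ger0_norm ?subr_ge0//; lra.
    rewrite distrC; apply: (le_trans (flip _ _ ab)).
    by move: vw; rewrite ler0_norm ?subr_le0//; lra.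
  have -> : v * f v + (ramp z al v - m) - (w * f w + (ramp z al w - m)) =
    ((v - w) * f v + w * (f v - f w)) + (ramp z al v - ramp z al w) by ring.
  apply: (le_trans (ler_normD _ _)); apply: lerD.
    apply: (le_trans (ler_normD _ _)); rewrite !normrM mulrDr; apply: lerD.
      by apply: ler_pM.
    by rewrite mulrC mulrA (mulrC be 2); apply: ler_wpM2r.
  (* Outside this window [v] and [w] lie on the same flat piece of the ramp, and the last difference
     vanishes. *)
  have [|/nandP out] := boolP (z - be <= w <= z + al + be).
    move=> _; rewrite mulr1; apply: (le_trans (ramp_lip _ _ _ al0)).
    by rewrite ler_wpM2r// invr_ge0 ltW.
  rewrite mulr0; move: vw; rewrite ler_norml => vw.
  case: out; rewrite -ltNge => out.
    by rewrite !ramp1 ?subrr ?normr0//; lra.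
  by rewrite !ramp0 ?subrr ?normr0//; lra.
- apply/andP; split; first by apply: zm => x; exact: ramp1.
  by apply: mz => x /ltW; exact: ramp0.
Qed.

End stein_solution.

(** * A Berry-Esseen bound under local dependence *)

Section finite_expectation.
Context {R : realType} (T : finType) (p : T -> R).
Hypothesis p_ge0 : forall t, 0 <= p t.
Hypothesis p_sum1 : \sum_t p t = 1.
Implicit Types g h : T -> R.

Definition Ex g : R := \sum_t p t * g t.

Lemma eq_Ex g h : g =1 h -> Ex g = Ex h.
Proof. by move=> gh; apply: eq_bigr => t _; rewrite gh. Qed.

Lemma ExD g h : Ex (fun t => g t + h t) = Ex g + Ex h.
Proof. by rewrite -big_split; apply: eq_bigr => t _; rewrite /= mulrDr. Qed.

Lemma ExB g h : Ex (fun t => g t - h t) = Ex g - Ex h.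
Proof. by rewrite -sumrB; apply: eq_bigr => t _; rewrite mulrBr. Qed.

Lemma ExZ c g : Ex (fun t => c * g t) = c * Ex g.
Proof. by rewrite mulr_sumr; apply: eq_bigr => t _; rewrite mulrCA. Qed.

Lemma Ex_cst c : Ex (fun=> c) = c.
Proof. by rewrite /Ex -mulr_suml p_sum1 mul1r. Qed.

Lemma Ex_sum (I : finType) (P : pred I) (G : I -> T -> R) :
  Ex (fun t => \sum_(i | P i) G i t) = \sum_(i | P i) Ex (G i).
Proof.
by rewrite exchange_big/=; apply: eq_bigr => t _; rewrite mulr_sumr.
Qed.

Lemma Ex_le g h : (forall t, g t <= h t) -> Ex g <= Ex h.
Proof. by move=> gh; apply: ler_sum => t _; rewrite ler_wpM2l. Qed.

Lemma Ex_norm_le g h : (forall t, `|g t| <= h t) -> `|Ex g| <= Ex h.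
Proof.
move=> gh; apply: (le_trans (ler_norm_sum _ _ _)); apply: ler_sum => t _.
by rewrite normrM ger0_norm// ler_wpM2l.
Qed.

End finite_expectation.

(** * Stein's method for bounded sums with dependency neighborhoods *)

Section berry_esseen.
Context {R : realType} (T : finType) (p : T -> R).
Hypothesis p_ge0 : forall t, 0 <= p t.
Hypothesis p_sum1 : \sum_t p t = 1.
Local Notation E := (Ex p).

Context (n : nat) (xi : 'I_n -> T -> R).
Context (N1 : 'I_n -> {set 'I_n}) (N2 : 'I_n -> 'I_n -> {set 'I_n}) (b D : R).
Hypothesis b_gt0 : 0 < b.
Hypothesis D_gt0 : 0 < D.
Hypothesis xi_le : forall i t, `|xi i t| <= b.
Hypothesis N1_le : forall i, #|N1 i|%:R <= D.
Hypothesis N2_le : forall i j, j \in N1 i -> #|N2 i j|%:R <= D.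

Let W t := \sum_i xi i t.
Let W1 i t := \sum_(k | k \notin N1 i) xi k t.
Let W2 i j t := \sum_(k | k \notin N2 i j) xi k t.
Let s i j := E (fun t => xi i t * xi j t).

(** Independence is expressed through expectations: a summand, or a centred product of two, is
    orthogonal to every function of the sum outside its neighborhood. *)
Hypothesis indep1 : forall i (g : R -> R), E (fun t => xi i t * g (W1 i t)) = 0.
Hypothesis indep2 : forall i j (g : R -> R), j \in N1 i ->
  E (fun t => (s i j - xi i t * xi j t) * g (W2 i j t)) = 0.
Hypothesis uncorrelated : forall i j, j \notin N1 i -> s i j = 0.
Hypothesis W_var : E (fun t => W t ^+ 2) = 1.

(** [be] bounds the sum over one neighborhood, and [tau] is the scale of the final error: for [b] of
    order n^(-1/2) it is of order D^2 / sqrt n. *)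
Let be := D * b.
Let tau := n%:R * b ^+ 3 * D ^+ 2.

Let be_gt0 : 0 < be. Proof. exact: mulr_gt0. Qed.

Let W_var_sum : \sum_i \sum_(j in N1 i) s i j = 1.
Proof.
rewrite -W_var [RHS](@eq_Ex _ _ _ _ (fun t => \sum_i \sum_j xi i t * xi j t)); last first.
  by move=> t; rewrite expr2 big_distrlr.
rewrite Ex_sum; apply: eq_bigr => i _; rewrite Ex_sum.
rewrite [RHS](bigID (mem (N1 i)))/= [X in _ + X]big1 ?addr0// => j.
exact: uncorrelated.
Qed.

Let prod_le i j t : `|xi i t * xi j t| <= b ^+ 2.
Proof. by rewrite normrM expr2; apply: ler_pM. Qed.

Let s_le i j : `|s i j| <= b ^+ 2.
Proof. by rewrite -[leRHS](Ex_cst p_sum1); apply: Ex_norm_le. Qed.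

Let double_sum_le (F : 'I_n -> 'I_n -> R) (c : R) : 0 <= c ->
  (forall i j, j \in N1 i -> `|F i j| <= c) ->
  `|\sum_i \sum_(j in N1 i) F i j| <= n%:R * (D * c).
Proof.
move=> c0 Fc; apply: (le_trans (ler_norm_sum _ _ _)).
have -> : n%:R * (D * c) = \sum_(i < n) D * c.
  by rewrite sumr_const card_ord mulr_natl.
apply: ler_sum => i _; apply: (le_trans (ler_norm_sum _ _ _)).
apply: (@le_trans _ _ (\sum_(j in N1 i) c)); first by apply: ler_sum => j /Fc.
by rewrite sumr_const -mulr_natl ler_wpM2r.
Qed.

(** The unit variance is a sum of at most [n * D] covariances of size [b ^+ 2], so [n * D * b ^+ 2]
    is at least 1; and [tau] is that number times [be]. *)
Let be_le_tau : be <= tau.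
Proof.
have h : 1 <= n%:R * (D * b ^+ 2).
  rewrite -[leLHS]W_var_sum; apply: (le_trans (ler_norm _)).
  by apply: double_sum_le => //; rewrite sqr_ge0.
have -> : tau = n%:R * (D * b ^+ 2) * be by rewrite /tau /be; ring.
by rewrite ler_peMl// ltW.
Qed.

Let tau_gt0 : 0 < tau. Proof. exact: lt_le_trans be_gt0 be_le_tau. Qed.

Let sum_in_le (A : {set 'I_n}) t : #|A|%:R <= D -> `|\sum_(k in A) xi k t| <= be.
Proof.
move=> AD; apply: (le_trans (ler_norm_sum _ _ _)).
apply: (@le_trans _ _ (\sum_(k in A) b)); first exact: ler_sum.
by rewrite sumr_const -mulr_natl ler_wpM2r// ltW.
Qed.

Let W_split (A : {set 'I_n}) t :
  W t = \sum_(k in A) xi k t + \sum_(k | k \notin A) xi k t.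
Proof. by rewrite /W (bigID (mem A)). Qed.

(** From |W| <= (1 + W^2) / 2 and the unit variance. *)
Let E_normW : E (fun t => `|W t|) <= 1.
Proof.
have <- : E (fun t => 2^-1 + 2^-1 * W t ^+ 2) = 1.
  by rewrite ExD ExZ W_var (Ex_cst p_sum1); field.
apply: Ex_le => // t.
by have := sqr_ge0 (`|W t| - 1); rewrite sqrrB expr1n mulr1 real_normK ?num_real//; lra.
Qed.

Let cdfW (z : R) := E (fun t => (W t <= z)%R%:R).

Let cdfW_le1 z : cdfW z <= 1.
Proof. by rewrite -[leRHS](Ex_cst p_sum1); apply: Ex_le => // t; case: (W t <= z)%R. Qed.

Let cdfW_ge0 z : 0 <= cdfW z.
Proof. by rewrite -[leLHS](Ex_cst p_sum1); apply: Ex_le => // t; case: (W t <= z)%R. Qed.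

Section stein_bound.
Context (z al del : R) (f df : R -> R).
Hypothesis al_gt0 : 0 < al.
Hypothesis del_ub : forall u, `|cdfW u - gauss_cdf u| <= del.
Hypothesis dfP : forall w : R, is_derive w 1 f (df w).
Let mod (w : R) := be * (5 + 2 * `|w|) + be / al * (z - be <= w <= z + al + be)%R%:R.
Hypothesis df_mod : forall w v, `|v - w| <= be -> `|df v - df w| <= mod w.

(** By the mean value theorem the remainder is [(df c - df w) * (w - v)] with [c] no farther from
    [w] than [v] is. *)
Let taylor w v : `|v - w| <= be -> `|f w - f v - (w - v) * df w| <= be * mod w.
Proof.
move=> vw; suff [c cw ->] : exists2 c, `|c - w| <= `|v - w| & f w - f v = df c * (w - v).
  rewrite [df c * _]mulrC -mulrBr normrM distrC; apply: ler_pM => //.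
  by apply: df_mod; exact: le_trans vw.
have H (a c : R) : a < c -> exists2 x, a < x < c & f c - f a = df x * (c - a).
  move=> ac; have [|x] := @MVT R f _ _ _ ac (fun x _ => dfP x).
    apply: continuous_subspaceT => y; apply: differentiable_continuous.
    by apply/derivable1_diffP; case: (dfP y).
  by rewrite in_itv; exists x.
have [wv|wv|->] := ltgtP w v; last by exists v; rewrite ?subrr ?mulr0.
- have [x xin Ex] := H _ _ wv; exists x; first by rewrite !ger0_norm; lra.
  by rewrite -opprB Ex; ring.
- have [x xin Ex] := H _ _ wv; exists x; first by rewrite !ler0_norm; lra.
  by rewrite Ex.
Qed.

Let Q := E (fun t => mod (W t)).

(** The window has Gaussian measure at most its length, and passing to the law of [W] costs [del] at
    each end. The 8 is 5 + 2 from the regular part, by [E_normW], plus 1 from [al / al]. *)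
Let Q_le : Q <= be * (8 + (3 * be + 2 * del) / al).
Proof.
have conc : E (fun t => (z - be <= W t <= z + al + be)%R%:R) <= al + 3 * be + 2 * del.
  (* The left end moves down to [z - 2 * be] because subtracting [cdfW (z - be)] would lose the atom
     at the closed endpoint. *)
  apply: (@le_trans _ _ (cdfW (z + al + be) - cdfW (z - 2 * be))).
    rewrite -ExB; apply: Ex_le => // t.
    have := be_gt0; have := al_gt0.
    case: (leP (z - be) (W t)) => ?; case: (leP (W t) (z + al + be)) => ?;
      case: (leP (W t) (z - 2 * be)) => ? ? ? /=; rewrite ?mulr1n ?mulr0n; lra.
  have := @gauss_cdf_lip R (z - 2 * be) (z + al + be).
  have := del_ub (z + al + be); have := del_ub (z - 2 * be).
  rewrite !ler_norml => ? ? H.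
  have /H : z - 2 * be <= z + al + be by have := be_gt0; have := al_gt0; lra.
  by lra.
rewrite /Q /mod ExD !ExZ ExD (Ex_cst p_sum1) ExZ.
have -> : be * (8 + (3 * be + 2 * del) / al)
    = be * (5 + 2 * 1) + be / al * (al + 3 * be + 2 * del).
  by field; rewrite gt_eqF.
apply: lerD; first by rewrite ler_pM2l// lerD2l ler_pM2l.
by rewrite ler_wpM2l// ltW// divr_gt0.
Qed.

Let mod_ge0 w : 0 <= mod w.
Proof. by apply: le_trans (@df_mod w w _); rewrite subrr normr0// ltW. Qed.

(** [F i j] is the error of replacing [W] by [W2 i j] in [df], where [indep2] gives 0; [r i] is the
    Taylor remainder between [W] and [W1 i], where [indep1] gives 0. There are at most [n * D]
    errors of size [2 * b ^+ 2 * Q] and [n] remainders of size [b * be * Q], in total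
    [3 * (n * D * b ^+ 2) * Q]. *)
Lemma stein_identity_bound :
  `|E (fun t => df (W t) - W t * f (W t))| <= 3 * tau * (8 + (3 * be + 2 * del) / al).
Proof.
pose F i j := E (fun t => (s i j - xi i t * xi j t) * (df (W t) - df (W2 i j t))).
pose r i := E (fun t => xi i t * (f (W t) - f (W1 i t) - (W t - W1 i t) * df (W t))).
have W1E i t : W t - W1 i t = \sum_(j in N1 i) xi j t.
  by rewrite (W_split (N1 i)) addrK.
have W2E i j t : W t - W2 i j t = \sum_(k in N2 i j) xi k t.
  by rewrite (W_split (N2 i j)) addrK.
have EF i : \sum_(j in N1 i) F i j =
    \sum_(j in N1 i) s i j * E (fun t => df (W t))
      - E (fun t => xi i t * (f (W t) - f (W1 i t))) + r i.
  have -> : \sum_(j in N1 i) s i j * E (fun t => df (W t))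
      = E (fun t => \sum_(j in N1 i) s i j * df (W t)).
    by rewrite Ex_sum; apply: eq_bigr => j _; rewrite ExZ.
  rewrite /r -ExB -ExD.
  transitivity (\sum_(j in N1 i) E (fun t => (s i j - xi i t * xi j t) * df (W t))).
    apply: eq_bigr => j jN; rewrite /F -[RHS]subr0 -(indep2 df jN) -ExB.
    by apply: eq_Ex => t; ring.
  rewrite -Ex_sum; apply: eq_Ex => t.
  rewrite W1E -mulr_suml -mulr_suml sumrB -mulr_sumr; ring.
have -> : E (fun t => df (W t) - W t * f (W t))
    = \sum_i \sum_(j in N1 i) F i j - \sum_i r i.
  rewrite ExB (eq_bigr _ (fun i _ => EF i)) big_split/= sumrB addrK.
  under [X in _ = X - _]eq_bigr do rewrite -mulr_suml.
  rewrite -mulr_suml W_var_sum mul1r -Ex_sum; congr (_ - _).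
  have -> : E (fun t => W t * f (W t)) = \sum_i E (fun t => xi i t * f (W t)).
    by rewrite -Ex_sum; apply: eq_Ex => t; rewrite mulr_suml.
  rewrite Ex_sum; apply: eq_bigr => i _.
  rewrite -[LHS]subr0 -(indep1 i f) -ExB; apply: eq_Ex => t; ring.
have Q0 : 0 <= Q by rewrite -(Ex_cst p_sum1 0); apply: Ex_le.
have F_le i j : j \in N1 i -> `|F i j| <= 2 * b ^+ 2 * Q.
  move=> jN; rewrite -ExZ; apply: Ex_norm_le => // t.
  rewrite normrM; apply: ler_pM => //.
    apply: (le_trans (ler_normB _ _)).
    by have := s_le i j; have := prod_le i j t; lra.
  by rewrite distrC; apply: df_mod; rewrite distrC W2E sum_in_le// N2_le.
have r_le i : `|r i| <= b * be * Q.
  rewrite -ExZ; apply: Ex_norm_le => // t; rewrite normrM -mulrA.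
  apply: ler_pM => //; apply: taylor.
  by rewrite distrC W1E sum_in_le.
have b2 := sqr_ge0 b.
apply: (le_trans (ler_normB _ _)).
apply: (@le_trans _ _ (n%:R * (D * (2 * b ^+ 2 * Q)) + n%:R * (b * be * Q))).
  apply: lerD.
    by apply: double_sum_le => //; rewrite mulr_ge0// mulr_ge0.
  apply: (le_trans (ler_norm_sum _ _ _)).
  rewrite -[leRHS](_ : \sum_(i < n) b * be * Q = _); first exact: ler_sum.
  by rewrite sumr_const card_ord mulr_natl.
have -> : n%:R * (D * (2 * b ^+ 2 * Q)) + n%:R * (b * be * Q) =
    3 * (n%:R * D * b ^+ 2) * Q by rewrite /be; ring.
have -> : 3 * tau * (8 + (3 * be + 2 * del) / al) =
    3 * (n%:R * D * b ^+ 2) * (be * (8 + (3 * be + 2 * del) / al)).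
  by rewrite /tau /be; ring.
by apply: ler_wpM2l; [rewrite !mulr_ge0// ltW|exact: Q_le].
Qed.

End stein_bound.

(* The Kolmogorov distance [del] reappears on the right with factor 1/2 because
   the smoothing width is [12 * tau]. *)
Let self_bound (del : R) : (forall u, `|cdfW u - gauss_cdf u| <= del) ->
  forall u, `|cdfW u - gauss_cdf u| <= 37 * tau + del / 2.
Proof.
move=> del_ub; pose al := 12 * tau; have t0 := tau_gt0.
have al0 : 0 < al by rewrite mulr_gt0.
have smooth z : exists2 m, gauss_cdf z <= m <= gauss_cdf (z + al) &
    `|E (fun t => ramp z al (W t)) - m| <= 25 * tau + del / 2.
  have [f [df [m [dfP steq _ dfmod mP]]]] := @stein_ramp R z al al0.
  exists m => //.
  have -> : E (fun t => ramp z al (W t)) - m = E (fun t => df (W t) - W t * f (W t)).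
    by rewrite -[X in _ - X](Ex_cst p_sum1 m) -ExB; apply: eq_Ex => t; rewrite steq.
  apply: (le_trans (stein_identity_bound al0 del_ub dfP _)) => [w v|].
    by apply: dfmod; exact: ltW.
  have -> : 3 * tau * (8 + (3 * be + 2 * del) / al) = 24 * tau + (3 * be + 2 * del) / 4.
    by rewrite /al; field; rewrite gt_eqF.
  by have := be_le_tau; lra.
(* The ramps started at [u] and at [u - al] bracket the indicator of [W <= u]. Each Gaussian mean is
   within [al = 12 * tau] of [gauss_cdf u], and 25 + 12 = 37. *)
move=> u; have [m mP] := smooth u; have [m' mP'] := smooth (u - al).
have up : cdfW u <= E (fun t => ramp u al (W t)).
  apply: Ex_le => // t; case: (leP (W t) u) => [/(ramp1 al0)->//|_].
  by have /andP[] := ramp01 u al (W t).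
have lo : E (fun t => ramp (u - al) al (W t)) <= cdfW u.
  apply: Ex_le => // t; case: (leP (W t) u) => [_|/ltW Wu].
    by have /andP[] := ramp01 (u - al) al (W t).
  by rewrite ramp0// subrK.
have := @gauss_cdf_lip R u (u + al); have := @gauss_cdf_lip R (u - al) u.
rewrite lerDl (ltW al0) gerBl (ltW al0) => /(_ isT) g1 /(_ isT) g2.
move: mP'; rewrite subrK !ler_norml /al in al0 up lo g1 g2 * => mP' h1 h2.
by lra.
Qed.

(** The supremum of the distances is finite, so [self_bound] applies with [del] equal to it, and the
    resulting inequality is solved for it. *)
Theorem berry_esseen_dependency (z : R) :
  `|E (fun t => (\sum_i xi i t <= z)%R%:R) - gauss_cdf z| <= 74 * tau.
Proof.
pose S := [set `|cdfW u - gauss_cdf u| | u in [set: R]].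
have S1 : ubound S 1.
  move=> _ [u _ <-]; have := cdfW_ge0 u; have := cdfW_le1 u.
  by have := gauss_cdf_ge0 u; have := gauss_cdf_le1 u; rewrite ler_norml; lra.
have Sub u : `|cdfW u - gauss_cdf u| <= sup S.
  by apply: ub_le_sup; [exists 1|exists u].
have : sup S <= 37 * tau + sup S / 2.
  apply: ge_sup; first by exists `|cdfW 0 - gauss_cdf 0|, 0.
  by move=> _ [u _ <-]; exact: self_bound.
by have := Sub z; rewrite /cdfW /W; lra.
Qed.

End berry_esseen.

(** * Patterns of threshold indicators *)

(** A finite union of finite intersections. Restricting to [A] over an arbitrary measurable type
    lets the same lemma serve for the sigma-algebra generated by a subfamily. *)
Lemma measurable_pattern d (T : measurableType d) n (E : 'I_n -> T -> bool)
    (A : {set 'I_n}) (Q : pred {set 'I_n}) :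
  (forall i, i \in A -> measurable [set t | E i t]) ->
  measurable [set t | Q ([set i | E i t] :&: A)%SET].
Proof.
move=> mE.
have -> : [set t | Q ([set i | E i t] :&: A)%SET] =
    \bigcup_(U in [set U | Q U]) \bigcap_(i in [set: 'I_n])
      [set t | E i t && (i \in A) = (i \in U)].
  apply/seteqP; split => t /=.
    by move=> Qt; exists ([set i | E i t] :&: A)%SET => //= i _ /=; rewrite !inE.
  move=> [U /= QU UE]; suff -> : ([set i | E i t] :&: A)%SET = U by [].
  by apply/setP => i; rewrite !inE; exact: UE.
apply: fin_bigcup_measurable; first exact: finite_finset.
move=> U _; apply: fin_bigcap_measurable; first exact: finite_finset.
move=> i _; have [iA|iA] := boolP (i \in A); last first.
  rewrite (_ : [set _ | _] = [set _ | false = (i \in U)]); last first.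
    by apply/seteqP; split => t /=; rewrite andbF.
  by case: (i \in U); [rewrite (_ : [set _ | _] = set0)|rewrite (_ : [set _ | _] = setT)] => //;
    apply/seteqP; split.
case: (i \in U).
  rewrite (_ : [set _ | _] = [set t | E i t]); first exact: mE.
  by apply/seteqP; split => t /=; rewrite andbT.
rewrite (_ : [set _ | _] = ~` [set t | E i t]); first exact/measurableC/mE.
by apply/seteqP; split => t /=; rewrite andbT; [move=> ->|move=> /negP/negbTE].
Qed.

(** * The finite law of the pattern and its independence properties *)

Section pattern_law.
Context d (T : measurableType d) (R : realType) (P : probability T R).
Context (n : nat) (X : 'I_n -> {RV P >-> R}).
Implicit Types (y : R) (A B S : {set 'I_n}).

Definition pattern y (t : T) : {set 'I_n} := [set i | X i t <= y]%SET.

Definition pattern_law y S : R := fine (P [set t | pattern y t = S]).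

Lemma measurable_RV_le i y : measurable [set t | X i t <= y].
Proof.
have -> : [set t | X i t <= y] = X i @^-1` `]-oo, y].
  by apply/seteqP; split => t; rewrite /= in_itv.
by rewrite -[X in measurable X]setTI; exact: measurable_funP.
Qed.

Lemma measurable_pattern_pred y (Q : pred {set 'I_n}) :
  measurable [set t | Q (pattern y t)].
Proof.
rewrite (_ : [set t | _] = [set t | Q ([set i | X i t <= y] :&: [set: 'I_n])%SET]).
  by apply: measurable_pattern => i _; exact: measurable_RV_le.
by apply/seteqP; split => t /=; rewrite finset.setIT.
Qed.

Lemma measurable_pattern_eq y S : measurable [set t | pattern y t = S].
Proof.
rewrite (_ : [set t | _] = [set t | pattern y t == S]).
  exact: (measurable_pattern_pred y (pred1 S)).
by apply/seteqP; split => t /= /eqP.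
Qed.

Lemma expectation_pattern y (g : {set 'I_n} -> R) :
  'E_P[fun t => g (pattern y t)]%E = (Ex (pattern_law y) g)%:E.
Proof.
rewrite unlock.
have -> : (\int[P]_w (g (pattern y w))%:E =
    \int[P]_w \sum_S ((g S * \1_[set t | pattern y t = S] w)%:E))%E.
  apply: eq_integral => t _; rewrite sumEFin; congr EFin.
  rewrite (bigD1 (pattern y t))//= big1 ?addr0 => [|S]; rewrite indicE.
    by rewrite mem_set// mulr1.
  by move=> St; rewrite memNset ?mulr0//= => E; rewrite E eqxx in St.
have int1 S : P.-integrable setT (EFin \o \1_[set t | pattern y t = S]).
  by apply: integrable_indic => //; exact: measurable_pattern_eq.
rewrite integral_sum//; last first.
  by move=> S; under eq_fun do rewrite EFinM; apply: integrableZl => //; exact: int1.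
rewrite /Ex -sumEFin; apply: eq_bigr => S _.
under eq_integral do rewrite EFinM.
rewrite integralZl//; last exact: int1.
rewrite integral_indic ?setIT//; last exact: measurable_pattern_eq.
rewrite mulrC EFinM /pattern_law fineK//.
by apply: fin_num_measure; exact: measurable_pattern_eq.
Qed.

Lemma prob_pattern y (Q : pred {set 'I_n}) :
  fine (P [set t | Q (pattern y t)]) = Ex (pattern_law y) (fun S => (Q S)%:R).
Proof.
rewrite -expectation_indic; last exact: measurable_pattern_pred.
have -> : \1_[set t | Q (pattern y t)] = (fun t => (Q (pattern y t))%:R : R).
  apply/funext => t; rewrite indicE; congr (_ %:R).
  by case: (boolP (Q _)) => Qt; [rewrite mem_set|rewrite memNset//=; exact/negP].
by rewrite (expectation_pattern y (fun S => (Q S)%:R)).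
Qed.

Lemma pattern_law_ge0 y S : 0 <= pattern_law y S.
Proof. by rewrite fine_ge0. Qed.

Lemma pattern_law_sum1 y : \sum_S pattern_law y S = 1.
Proof.
have := prob_pattern y xpredT.
rewrite (_ : [set t | _] = setT) ?probability_setT; last exact/seteqP.
by rewrite /Ex => /= ->; apply: eq_bigr => S _; rewrite mulr1.
Qed.

Lemma rcdf_pattern y i :
  rcdf (X i) y = Ex (pattern_law y) (fun S => (i \in S)%:R).
Proof.
rewrite -(prob_pattern y (fun S => i \in S)) /rcdf /cdf /distribution /pushforward.
congr (fine (P _)); apply/seteqP; split => t /=; rewrite in_itv /pattern/= inE//.
Qed.

(** Both sides are expanded over the values [U] and [V] of the two restricted patterns; the
    corresponding events lie in the two independent sigma-algebras, so the joint weights factor. *)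
Lemma Ex_pattern_indep y A B (g h : {set 'I_n} -> R) : indep_subfamilies X A B ->
  Ex (pattern_law y) (fun S => g (S :&: A)%SET * h (S :&: B)%SET) =
  Ex (pattern_law y) (fun S => g (S :&: A)%SET) * Ex (pattern_law y) (fun S => h (S :&: B)%SET).
Proof.
move=> indAB.
pose q A' U := fine (P [set t | (pattern y t :&: A')%SET == U]).
have sig A' U : sigma_alg X A' [set t | (pattern y t :&: A')%SET == U].
  (* The generated sigma-algebra becomes the ambient measurable structure, in which the indicators
     indexed by [A'] are measurable. *)
  rewrite /sigma_alg; set G := (X in <<s X >>).
  apply: (@measurable_pattern _ (g_sigma_algebraType G) n (fun i t => X i t <= y) A' (pred1 U)).
  move=> i iA; apply: sub_sigma_algebra; exists i => //=.
  exists `]-oo, y]%classic; first exact: measurable_itv.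
  by rewrite setTI; apply/seteqP; split => t /=; rewrite in_itv.
have law2 (U V : {set 'I_n}) : fine (P [set t | ((pattern y t :&: A)%SET == U) && ((pattern y t :&: B)%SET == V)])
    = q A U * q B V.
  rewrite (_ : [set t | _] = [set t | (pattern y t :&: A)%SET == U] `&`
     [set t | (pattern y t :&: B)%SET == V]); last first.
    by apply/seteqP; split => t /=; [move/andP|move=> ?; apply/andP].
  rewrite (indAB _ _ (sig A U) (sig B V)) fineM//; apply: fin_num_measure;
  [exact: (measurable_pattern_pred y (fun S => (S :&: A)%SET == U))|
   exact: (measurable_pattern_pred y (fun S => (S :&: B)%SET == V))].
have one (A' : {set 'I_n}) (k : {set 'I_n} -> R) :
    Ex (pattern_law y) (fun S => k (S :&: A')%SET) = \sum_U k U * q A' U.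
  rewrite (eq_bigr (fun U => Ex (pattern_law y) (fun S => k U * ((S :&: A')%SET == U)%:R))).
    rewrite -Ex_sum; apply: eq_Ex => S.
    rewrite (bigD1 (S :&: A')%SET)//= eqxx mulr1 big1 ?addr0// => U /negPf.
    by rewrite eq_sym => ->; rewrite mulr0.
  by move=> U _; rewrite ExZ -(prob_pattern y (fun S => (S :&: A')%SET == U)).
rewrite !one big_distrlr/=.
rewrite (eq_bigr (fun U => \sum_V Ex (pattern_law y)
   (fun S => g U * h V * (((S :&: A)%SET == U) && ((S :&: B)%SET == V))%:R))); last first.
  move=> U _; apply: eq_bigr => V _; rewrite ExZ.
  rewrite -(prob_pattern y (fun S => ((S :&: A)%SET == U) && ((S :&: B)%SET == V))).
  by rewrite law2 mulrACA.
under eq_bigr do rewrite -Ex_sum.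
rewrite -Ex_sum; apply: eq_Ex => S.
rewrite (bigD1 (S :&: A)%SET)//= (bigD1 (S :&: B)%SET)//= !eqxx mulr1.
rewrite big1 ?addr0 => [|V /negPf]; last by rewrite eq_sym => ->; rewrite mulr0.
rewrite big1 ?addr0// => U /negPf UA; rewrite big1// => V _.
by rewrite eq_sym UA mulr0.
Qed.

(** Invariance under intersection with [A] encodes dependence on the indicators in [A] alone. *)
Corollary Ex_pattern_mul y A B (g h : {set 'I_n} -> R) : indep_subfamilies X A B ->
  (forall S, g (S :&: A)%SET = g S) -> (forall S, h (S :&: B)%SET = h S) ->
  Ex (pattern_law y) (fun S => g S * h S) =
  Ex (pattern_law y) g * Ex (pattern_law y) h.
Proof.
move=> /(@Ex_pattern_indep y A B g h) + gA hB; rewrite (eq_Ex _ gA) (eq_Ex _ hB) => <-.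
by apply: eq_Ex => S; rewrite gA hB.
Qed.

Definition cindic y i S : R := (i \in S)%:R - rcdf (X i) y.

Definition pattern_var y : R := Ex (pattern_law y) (fun S => (\sum_i cindic y i S) ^+ 2).

Lemma Ex_cindic y i : Ex (pattern_law y) (cindic y i) = 0.
Proof.
rewrite /cindic ExB -rcdf_pattern (Ex_cst (pattern_law_sum1 y)).
by rewrite subrr.
Qed.

Lemma sigma2_pattern_var : sigma2 X = n%:R^-1 * pattern_var 0.
Proof.
rewrite /sigma2; congr (_ * _).
pose g S := \sum_i cindic 0 i S.
have -> : (fun t => \sum_(i < n) (\1_[set s | X i s <= 0] t - rcdf (X i) 0)) =
    (fun t => g (pattern 0 t)).
  apply/funext => t; apply: eq_bigr => i _; rewrite /cindic indicE /pattern inE.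
  congr (_ %:R - _); case: (boolP (X i t <= 0)) => h; first by rewrite mem_set.
  by rewrite memNset//=; exact/negP.
rewrite /variance unlock.
rewrite expectation_pattern /g Ex_sum big1 => [|i _]; last exact: Ex_cindic.
have -> : (((fun t => g (pattern 0 t)) \- cst (fine 0%:E)) *
    ((fun t => g (pattern 0 t)) \- cst (fine 0%:E)))%R =
    (fun t => (fun S => g S ^+ 2) (pattern 0 t)).
  by apply/funext => t; rewrite /GRing.mul/= subr0 expr2.
by rewrite (expectation_pattern 0 (fun S => g S ^+ 2)).
Qed.

Lemma rcdf01 y i : 0 <= rcdf (X i) y <= 1.
Proof.
rewrite /rcdf fine_ge0//= -lee_fin fineK ?cdf_le1//.
by rewrite fin_num_measure//; exact: measurable_itv.
Qed.

Lemma cindic_le1 y i S : `|cindic y i S| <= 1.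
Proof.
have := rcdf01 y i; rewrite /cindic ler_norml.
by case: (i \in S); rewrite ?mulr1n ?mulr0n; lra.
Qed.

End pattern_law.

(** * The sample median in terms of counts *)

Section sample_median_le.
Context (R : realType) (n : nat) (x : 'I_n -> R).

Let count (y : R) := #|[set i | (x i <= y)%R]%SET|.

Let count_le (y y' : R) : y <= y' -> (count y <= count y')%N.
Proof.
move=> yy'; apply/subset_leq_card/fintype.subsetP => i; rewrite !inE => /le_trans; exact.
Qed.

Let sum_norm_ge i : `|x i| <= \sum_j `|x j|.
Proof. by rewrite (bigD1 i)//= lerDl sumr_ge0. Qed.

(** If the count at [y] exceeds [n./2], monotonicity puts every point of the set below [y].
    Otherwise some observation exceeds [y]; the count is still at most [n./2] halfway between [y]
    and the smallest such observation, so the supremum is above [y]. *)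
Lemma sample_median_leE (y : R) : (0 < n)%N ->
  (sample_median x <= y) = (n./2 < count y)%N.
Proof.
move=> n0; set S := [set y : R | (count y <= n./2)%N].
have n2 : (n./2 < n)%N by rewrite -divn2 ltn_Pdiv.
apply/idP/idP => [|cy]; last first.
  apply: ge_sup.
    (* This point lies below all observations; it shows the set to be nonempty, as the supremum
       requires. *)
    exists (- (\sum_j `|x j|) - 1) => /=; rewrite [X in (X <= _)%N](_ : _ = 0%N)//.
    apply/eqP; rewrite cards_eq0; apply/eqP/setP => i; rewrite !inE; apply/negbTE.
    by rewrite -ltNge; have := sum_norm_ge i; rewrite ler_norml; lra.
  move=> z /= cz; rewrite leNgt; apply/negP => /ltW /count_le.
  by move=> /(leq_trans cy); rewrite ltnNge cz.
apply: contraLR; rewrite -leqNgt -ltNge => cy.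
have [i0 yi0] : exists i0, y < x i0.
  apply/not_existsP => H; suff : (n <= n./2)%N by rewrite leqNgt n2.
  apply: leq_trans cy; rewrite -[X in (X <= _)%N]card_ord -cardsT.
  apply/subset_leq_card/fintype.subsetP => i _; rewrite inE leNgt; exact/negP.
case: (@arg_minP _ _ _ i0 (fun i => y < x i) x yi0) => i yi imin.
apply: (@lt_le_trans _ _ ((y + x i) / 2)); first by lra.
apply: ub_le_sup.
  exists (\sum_j `|x j|) => z /= cz; rewrite leNgt; apply/negP => zlt.
  suff : (n <= n./2)%N by rewrite leqNgt n2.
  apply: leq_trans cz; rewrite -[X in (X <= _)%N]card_ord -cardsT.
  apply/subset_leq_card/fintype.subsetP => j _; rewrite inE.
  by rewrite (le_trans (ler_norm _))// (le_trans (sum_norm_ge j))// ltW.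
apply: leq_trans cy; apply/subset_leq_card/fintype.subsetP => j; rewrite !inE => jle.
by rewrite leNgt; apply/negP => /imin; move: jle; lra.
Qed.

End sample_median_le.

(** * Normal approximation of the count at a fixed level, and its variance *)

Section pattern_berry_esseen.
Context d (T : measurableType d) (R : realType) (P : probability T R).
Context (n : nat) (X : 'I_n -> {RV P >-> R}).
Context (N1 : 'I_n -> {set 'I_n}) (N2 : 'I_n -> 'I_n -> {set 'I_n})
  (N3 : 'I_n -> 'I_n -> 'I_n -> {set 'I_n}) (D : R).
Hypothesis dep : dependency_neighborhoods X N1 N2 N3.
Hypothesis D_gt0 : 0 < D.
Hypothesis N1_le : forall i, #|N1 i|%:R <= D.
Hypothesis N2_le : forall i j, j \in N1 i -> #|N2 i j|%:R <= D.
Implicit Types (y z : R) (A S : {set 'I_n}).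

Let cindicI y i A S : i \in A -> cindic X y i (S :&: A)%SET = cindic X y i S.
Proof. by move=> iA; rewrite /cindic inE iA andbT. Qed.

Let sum_cindicI y A (k : R) S :
  \sum_(i in A) cindic X y i S / k = \sum_(i in A) cindic X y i (S :&: A)%SET / k.
Proof. by apply: eq_bigr => i iA; rewrite cindicI. Qed.

Definition cindic_cov y i j : R :=
  Ex (pattern_law X y) (fun S => cindic X y i S * cindic X y j S).

Lemma cindic_cov0 y i j : j \notin N1 i -> cindic_cov y i j = 0.
Proof.
move=> jN; have [dep1 _ _] := dep; have [_ ind] := dep1 i.
rewrite /cindic_cov (Ex_pattern_mul y ind) ?Ex_cindic ?mul0r// => S.
  by rewrite cindicI ?inE.
by rewrite cindicI ?inE.
Qed.

Lemma pattern_var_cov y : pattern_var X y = \sum_i \sum_(j in N1 i) cindic_cov y i j.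
Proof.
rewrite /pattern_var.
rewrite [LHS](@eq_Ex _ _ _ _ (fun S => \sum_i \sum_j cindic X y i S * cindic X y j S)); last first.
  by move=> S; rewrite expr2 big_distrlr.
rewrite Ex_sum; apply: eq_bigr => i _; rewrite Ex_sum.
rewrite (bigID (mem (N1 i)))/= [X in _ + X]big1 ?addr0// => j.
exact: (cindic_cov0 y).
Qed.

(** The summands are the centred indicators divided by their total standard deviation [v], so [b] is
    [v^-1]. *)
Lemma pattern_berry_esseen y z : 0 < pattern_var X y ->
  `|Ex (pattern_law X y)
      (fun S => (\sum_i cindic X y i S <= z * Num.sqrt (pattern_var X y))%R%:R)
    - gauss_cdf z| <= 74 * (n%:R * (Num.sqrt (pattern_var X y))^-1 ^+ 3 * D ^+ 2).
Proof.
move=> V0; set v := Num.sqrt _; have v0 : 0 < v by rewrite sqrtr_gt0.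
have [dep1 dep2 _] := dep.
pose xi i S := cindic X y i S / v.
have xisum (Q : pred 'I_n) S : \sum_(i | Q i) xi i S = (\sum_(i | Q i) cindic X y i S) / v.
  by rewrite mulr_suml.
have s_xi i j : Ex (pattern_law X y) (fun S => xi i S * xi j S) = v ^- 2 * cindic_cov y i j.
  by rewrite -ExZ; apply: eq_Ex => S; rewrite /xi -exprVn; ring.
(* In this form the sum visibly depends only on the pattern outside the neighborhood. *)
have W1I i S : \sum_(k | k \notin N1 i) xi k S =
    \sum_(k in ~: N1 i) xi k (S :&: ~: N1 i)%SET.
  rewrite /xi -sum_cindicI; apply: eq_bigl => k; by rewrite inE.
have W2I i j S : \sum_(k | k \notin N2 i j) xi k S =
    \sum_(k in ~: N2 i j) xi k (S :&: ~: N2 i j)%SET.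
  rewrite /xi -sum_cindicI; apply: eq_bigl => k; by rewrite inE.
rewrite [X in `|X - _|](_ : _ =
   Ex (pattern_law X y) (fun S => (\sum_i xi i S <= z)%R%:R)); last first.
  by apply: eq_Ex => S; rewrite xisum ler_pdivrMr.
apply: (@berry_esseen_dependency _ _ _ (pattern_law_ge0 X y) (pattern_law_sum1 X y)
  n xi N1 N2) => //.
- by rewrite invr_gt0.
- move=> i S; rewrite /xi normrM normfV (gtr0_norm v0) ler_piMl ?cindic_le1//.
  by rewrite invr_ge0 ltW.
- move=> i g; have [_ ind] := dep1 i.
  rewrite (@Ex_pattern_mul _ _ _ _ _ X y _ _ (xi i)
    (fun S => g (\sum_(k | k \notin N1 i) xi k S)) ind).
  + rewrite (@eq_Ex _ _ _ _ (fun S => v^-1 * cindic X y i S)) ?ExZ ?Ex_cindic ?mulr0 ?mul0r//.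
    by move=> S; rewrite /xi mulrC.
  + by move=> S; rewrite /xi cindicI ?inE.
  + by move=> S; rewrite !W1I -finset.setIA finset.setIid.
- move=> i j g jN; have [_ ind] := dep2 i j jN.
  rewrite (@Ex_pattern_mul _ _ _ _ _ X y _ _
    (fun S => Ex (pattern_law X y) (fun S => xi i S * xi j S) - xi i S * xi j S)
    (fun S => g (\sum_(k | k \notin N2 i j) xi k S)) ind).
  + by rewrite ExB (Ex_cst (pattern_law_sum1 X y)) subrr mul0r.
  + by move=> S; rewrite /xi !cindicI ?inE ?eqxx ?orbT.
  + by move=> S; rewrite !W2I -finset.setIA finset.setIid.
- by move=> i j jN; rewrite s_xi cindic_cov0// mulr0.
- rewrite (@eq_Ex _ _ _ _ (fun S => v ^- 2 * (\sum_i cindic X y i S) ^+ 2)) => [|S].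
    by rewrite ExZ -/(pattern_var X y) sqr_sqrtr ?mulVf ?gt_eqF ?ltW.
  by rewrite xisum expr_div_n mulrC.
Qed.

Let joint y i j := fine (P ([set t | X i t <= y] `&` [set t | X j t <= y])).

(** When both variables are at most [y'], either both are at most [y] or one of them falls in the
    increment between [y] and [y']. *)
Let joint_lip y y' i j : y <= y' ->
  0 <= joint y' i j - joint y i j <=
    (rcdf (X i) y' - rcdf (X i) y) + (rcdf (X j) y' - rcdf (X j) y).
Proof.
move=> yy'; pose E k u := [set t | X k t <= u].
have mE k u : measurable (E k u) by exact: measurable_RV_le.
have FE k u : rcdf (X k) u = fine (P (E k u)).
  by rewrite /rcdf /cdf /distribution /pushforward; congr (fine (P _)).
have sub k : E k y `<=` E k y' by move=> t /= /le_trans; exact.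
have fP (B : set T) : measurable B -> P B \is a fin_num by move=> mB; apply: fin_num_measure.
have dif k : fine (P (E k y' `\` E k y)) = rcdf (X k) y' - rcdf (X k) y.
  rewrite measureD// ?ltey_eq ?fP// fineB ?fP//; last exact: measurableI.
  by rewrite !FE (setIidr (@sub k)).
have mI u : measurable (E i u `&` E j u) by exact: measurableI.
have mD k : measurable (E k y' `\` E k y) by exact: measurableD.
rewrite subr_ge0 -2!dif lerBlDl /joint -!/(E _ _); apply/andP; split.
  apply: fine_le; [exact/fP/mI|exact/fP/mI|].
  apply: le_measure; rewrite ?inE; [exact: mI|exact: mI|].
  by move=> t [] /sub ? /sub ?.
rewrite -!fineD ?fin_numD ?fP//.
apply: fine_le; [exact/fP/mI|by rewrite !fin_numD !fP|].
apply: (@le_trans _ _ (P ((E i y `&` E j y) `|` ((E i y' `\` E i y) `|` (E j y' `\` E j y))))).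
  apply: le_measure; rewrite ?inE; [exact: mI| |].
    by apply: measurableU; [exact: mI|exact: measurableU].
  move=> t [Ei Ej]; have [Ei'|Ei'] := pselect (E i y t); last by right; left.
  by have [Ej'|Ej'] := pselect (E j y t); [left|right; right].
apply: (le_trans (measureU2 _ (mI y) (measurableU _ _ (mD i) (mD j)))).
by apply: leeD => //; exact: (measureU2 _ (mD i) (mD j)).
Qed.

Let cindic_covE y i j : cindic_cov y i j = joint y i j - rcdf (X i) y * rcdf (X j) y.
Proof.
have -> : joint y i j = Ex (pattern_law X y) (fun S => ((i \in S) && (j \in S))%:R).
  rewrite -(prob_pattern X y (fun S => (i \in S) && (j \in S))) /joint.
  congr (fine (P _)); apply/seteqP; split => t /=; rewrite /pattern !inE; first by move=> ?; apply/andP.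
  by move/andP.
rewrite /cindic_cov.
rewrite (@eq_Ex _ _ _ _ (fun S => ((i \in S) && (j \in S))%:R - (rcdf (X i) y * (j \in S)%:R
   + (rcdf (X j) y * (i \in S)%:R - rcdf (X i) y * rcdf (X j) y)))) => [|S].
  rewrite ExB ExD ExB !ExZ (Ex_cst (pattern_law_sum1 X y)) -!rcdf_pattern; ring.
by rewrite /cindic; case: (i \in S); case: (j \in S) => /=; ring.
Qed.

(** At most [n * D] covariances can be nonzero, and each moves by at most [4 * e]: half from the
    joint probability, half from the product of marginals. *)
Lemma pattern_var_lip y (e : R) :
  (forall i, `|rcdf (X i) y - rcdf (X i) 0| <= e) ->
  `|pattern_var X y - pattern_var X 0| <= n%:R * D * (4 * e).
Proof.
move=> Fe.
have cov_lip i j : `|cindic_cov y i j - cindic_cov 0 i j| <= 4 * e.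
  rewrite !cindic_covE.
  have J : `|joint y i j - joint 0 i j| <= 2 * e.
    have := Fe i; have := Fe j; rewrite !ler_norml.
    by have [/ltW y0|y0] := ltP 0 y; have := joint_lip i j y0; lra.
  have Q : `|rcdf (X i) y * rcdf (X j) y - rcdf (X i) 0 * rcdf (X j) 0| <= 2 * e.
    have -> : rcdf (X i) y * rcdf (X j) y - rcdf (X i) 0 * rcdf (X j) 0 =
      (rcdf (X i) y - rcdf (X i) 0) * rcdf (X j) y +
      rcdf (X i) 0 * (rcdf (X j) y - rcdf (X j) 0) by ring.
    rewrite (le_trans (ler_normD _ _))// !normrM mulr_natl mulr2n.
    have n1 u k : `|rcdf (X k) u| <= 1 by have := rcdf01 X u k; rewrite ler_norml; lra.
    apply: lerD; first by rewrite -[leRHS]mulr1; apply: ler_pM.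
    by rewrite -[leRHS]mul1r; apply: ler_pM.
  by move: J Q; rewrite !ler_norml; lra.
rewrite !pattern_var_cov -sumrB.
apply: (le_trans (ler_norm_sum _ _ _)).
have -> : n%:R * D * (4 * e) = \sum_(i < n) D * (4 * e).
  by rewrite sumr_const card_ord -[RHS]mulr_natl !mulrA.
apply: ler_sum => i _; rewrite -sumrB; apply: (le_trans (ler_norm_sum _ _ _)).
apply: (@le_trans _ _ (\sum_(j in N1 i) 4 * e)); first exact: ler_sum.
rewrite sumr_const -[leLHS]mulr_natl ler_wpM2r//.
by apply: le_trans (cov_lip i i).
Qed.

End pattern_berry_esseen.

(** * The sample median *)

Section taylor.
Context {R : realType}.
Implicit Types (f F : R -> R) (eps A y : R).

Lemma MVT_at0 f eps y : (forall x, `|x| <= eps -> derivable f x 1) ->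
  `|y| <= eps -> exists2 c, `|c| <= `|y| & f y - f 0 = f^`()%classic c * y.
Proof.
move=> df yeps.
have H a b : a < b -> (forall x, a <= x <= b -> `|x| <= eps) ->
    exists2 c, a < c < b & f b - f a = f^`()%classic c * (b - a).
  move=> ab abe; have [||c] := @MVT R f f^`()%classic a b ab.
  - move=> x; rewrite in_itv/= => /andP[ax xb]; rewrite derive1E.
    by apply: derivableP; apply: df; apply: abe; rewrite !ltW.
  - apply: derivable_within_continuous => x; rewrite in_itv/= => /abe; exact: df.
  by rewrite in_itv; exists c.
have [y0|y0|->] := ltgtP y 0; last by exists 0; rewrite ?subrr ?mulr0.
- have [x xy|c cy E] := H _ _ y0.
    by apply: le_trans yeps; rewrite !ler0_norm; lra.
  exists c; first by rewrite !ler0_norm; lra.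
  by rewrite -opprB E; ring.
- have [x xy|c cy E] := H _ _ y0.
    by apply: le_trans yeps; rewrite !ger0_norm; lra.
  exists c; first by rewrite !ger0_norm; lra.
  by rewrite E subr0.
Qed.

Lemma derivs_bounded_lip F eps A y : derivs_bounded_on eps A F -> `|y| <= eps ->
  `|F y - F 0| <= A * `|y|.
Proof.
move=> FA yeps; have [|c cy ->] := @MVT_at0 F eps y _ yeps; first by move=> x /FA[].
have [_ _ _ dA] := FA c (le_trans cy yeps).
by rewrite normrM ler_wpM2r.
Qed.

(** Two uses of the mean value theorem, first for [F] and then for its derivative; this gives [A] in
    place of the sharper [A / 2]. *)
Lemma derivs_bounded_taylor F eps A y : derivs_bounded_on eps A F -> `|y| <= eps ->
  `|F y - F 0 - F^`()%classic 0 * y| <= A * y ^+ 2.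
Proof.
move=> FA yeps; have [|c cy ->] := @MVT_at0 F eps y _ yeps; first by move=> x /FA[].
rewrite -mulrBl.
have [|c' cc ->] := @MVT_at0 F^`()%classic eps c _ (le_trans cy yeps).
  by move=> x /FA[].
have [_ _ d2 _] := FA c' (le_trans cc (le_trans cy yeps)).
by rewrite !normrM -[y ^+ 2]real_normK ?num_real// expr2 mulrA ler_wpM2r// ler_pM.
Qed.

End taylor.

(** Beyond [u] both monotone functions lie between their values at [u] and 1, and symmetrically
    below [- u]; the Gaussian tail is at most [2 / u ^+ 2]. *)
Lemma kolmogorov_tail (R : realType) (G : R -> R) (u del : R) : 0 < u ->
  {homo G : x y / x <= y} -> (forall x, 0 <= G x <= 1) ->
  (forall x, `|x| <= u -> `|G x - gauss_cdf x| <= del) ->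
  forall x, `|G x - gauss_cdf x| <= del + 2 / u ^+ 2.
Proof.
move=> u0 Gm G01 Gd x; have u2 : 0 < u ^+ 2 by rewrite exprn_gt0.
have tail : 1 - gauss_cdf u <= 2 / u ^+ 2.
  by rewrite ler_pdivlMr// mulrC gauss_tail.
have tail0 : 0 <= 2 / u ^+ 2 by rewrite divr_ge0// ltW.
have [/Gd|] := lerP `|x| u; first by lra.
have := Gd u; rewrite gtr0_norm// lexx => /(_ isT).
have := Gd (- u); rewrite normrN gtr0_norm// lexx gauss_cdfN => /(_ isT).
have := gauss_cdf_le1 x; have := gauss_cdf_ge0 x; have := G01 x.
rewrite ltr_normr => G1 P0 P1 Hu Hu'.
move=> /orP[ux|ux].
  have := Gm _ _ (ltW ux); have := gauss_cdf_le (ltW ux).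
  by move: Hu Hu'; rewrite !ler_norml; lra.
have ux' : x <= - u by lra.
have := Gm _ _ ux'; have := gauss_cdf_le ux'; rewrite gauss_cdfN.
by move: Hu Hu'; rewrite !ler_norml; lra.
Qed.

Lemma half_bounds (R : realFieldType) n :
  n./2%:R <= (n%:R / 2 : R) <= n./2%:R + 2^-1.
Proof.
have -> : n%:R = (odd n)%:R + n./2%:R * 2 :> R.
  by rewrite -[in LHS](odd_double_half n) natrD -muln2 natrM.
by case: (odd n); rewrite ?mulr1n ?mulr0n; lra.
Qed.

(** * Normal approximation of the normalized median *)

Section median_berry_esseen.
Context d (T : measurableType d) (R : realType) (P : probability T R).
Context (n : nat) (X : 'I_n -> {RV P >-> R}).
Context (N1 : 'I_n -> {set 'I_n}) (N2 : 'I_n -> 'I_n -> {set 'I_n})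
  (N3 : 'I_n -> 'I_n -> 'I_n -> {set 'I_n}) (D eps A c C : R).
Hypothesis n_gt0 : (0 < n)%N.
Hypothesis dep : dependency_neighborhoods X N1 N2 N3.
Hypothesis D_ge1 : 1 <= D.
Hypothesis N1_le : forall i, #|N1 i|%:R <= D.
Hypothesis N2_le : forall i j, j \in N1 i -> #|N2 i j|%:R <= D.
Hypothesis eps_gt0 : 0 < eps.
Hypothesis A_gt0 : 0 < A.
Hypothesis c_gt0 : 0 < c.
Hypothesis regF : forall i, cdf_regularity eps A (rcdf (X i)).
Hypothesis sigma2_cC : c < sigma2 X < C.
Hypothesis theta_cC : c < theta X < C.

(* Variables with equations rather than local definitions, so that unification
   does not unfold them. *)
Context (r s0 th : R).
Hypothesis rE : r = Num.sqrt n%:R.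
Hypothesis s0E : s0 = Num.sqrt (sigma2 X).
Hypothesis thE : th = theta X.

Let r_ge1 : 1 <= r.
Proof. by rewrite rE -[leLHS]sqrtr1 ler_wsqrtr// ler1n. Qed.

Let r2 : r ^+ 2 = n%:R.
Proof. by rewrite rE sqr_sqrtr. Qed.

Let r_gt0 : 0 < r. Proof. by have := r_ge1; lra. Qed.

Let s0_gt0 : 0 < s0.
Proof. by rewrite s0E sqrtr_gt0; have := sigma2_cC; have := c_gt0; lra. Qed.

Let s02 : s0 ^+ 2 = sigma2 X.
Proof. by rewrite s0E sqr_sqrtr//; have := sigma2_cC; have := c_gt0; lra. Qed.

Definition median_cdf (x : R) : R :=
  fine (P [set t | th * r / s0 * sample_median (fun i => X i t) <= x]).

(** The threshold for the data: the normalized median is at most [x] exactly when the median is at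
    most [level x]. *)
Let level x := x * s0 / (th * r).

Let th_gt0 : 0 < th. Proof. by have := theta_cC; have := c_gt0; rewrite -thE; lra. Qed.

Let median_set x : [set t | th * r / s0 * sample_median (fun i => X i t) <= x]
  = [set t | (n./2 < #|pattern X (level x) t|)%N].
Proof.
have E M : (th * r / s0 * M <= x) = (M <= level x).
  have -> : (th * r / s0 * M <= x) = (th * r / s0 * M * s0 <= x * s0) by rewrite ler_pM2r.
  rewrite /level ler_pdivlMr ?mulr_gt0//.
  by congr (_ <= _); field; rewrite gt_eqF.
by apply/seteqP; split => t /=; rewrite E sample_median_leE.
Qed.

Lemma median_cdf_homo : {homo median_cdf : x y / x <= y}.
Proof.
have m x : measurable [set t | th * r / s0 * sample_median (fun i => X i t) <= x].
  by rewrite median_set; exact: (measurable_pattern_pred X _ (fun S => n./2 < #|S|)%N).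
move=> x y xy; apply: fine_le; rewrite ?fin_num_measure//.
by apply: le_measure; rewrite ?inE// => t /= /le_trans; exact.
Qed.

Lemma median_cdf01 x : 0 <= median_cdf x <= 1.
Proof.
have m : measurable [set t | th * r / s0 * sample_median (fun i => X i t) <= x].
  by rewrite median_set; exact: (measurable_pattern_pred X _ (fun S => n./2 < #|S|)%N).
rewrite /median_cdf fine_ge0//= -lee_fin fineK ?fin_num_measure//.
exact: probability_le1.
Qed.

(** Passing to the complement turns a count above [n./2] into a lower tail of the centred sum, the
    form of the Berry-Esseen bound. *)
Let median_cdf_pattern x : median_cdf x = 1 - Ex (pattern_law X (level x))
  (fun S => (\sum_i cindic X (level x) i S <= n./2%:R - \sum_i rcdf (X i) (level x))%R%:R).
Proof.
rewrite /median_cdf median_set (prob_pattern X _ (fun S => n./2 < #|S|)%N).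
rewrite -[X in X - _](Ex_cst (pattern_law_sum1 X (level x))) -ExB; apply: eq_Ex => S.
have cardS : \sum_i ((i \in S)%:R : R) = #|S|%:R.
  by rewrite -sum1_card natr_sum [RHS]big_mkcond; apply: eq_bigr => i _; case: (i \in S).
rewrite /cindic sumrB lerD2r cardS ler_nat ltnNge.
by case: (#|S| <= n./2)%N; rewrite ?subr0 ?subrr.
Qed.

(** [sc] bounds from below the standard deviation of the count divided by [r]. [K1] is the constant
    for the error of the standardized level: its first term pays for the change of standard
    deviation, its second for Taylor's remainder and the rounding of n/2. *)
Let sc : R := Num.sqrt (c / 2).
Let K1 : R := 4 * A * Num.sqrt C / (c * Num.sqrt c * sc) + (A * C / c ^+ 2 + 1) / sc.
(* For |x| D <= kap n^{1/4} the three bounds give, at the level y of x: |y| <= eps,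
   a variance of at least n c / 2, and |w - x| <= |x| / 2 + 1 for the
   standardized level w. *)
Let kap : R := Num.min (eps * c / Num.sqrt C)
  (Num.min (c ^+ 2 / (8 * A * Num.sqrt C)) (2 * K1)^-1).

Let C_gt0 : 0 < C. Proof. by have := sigma2_cC; have := c_gt0; lra. Qed.
Let sC_gt0 : 0 < Num.sqrt C. Proof. by rewrite sqrtr_gt0. Qed.
Let sc_gt0 : 0 < sc. Proof. by rewrite sqrtr_gt0 divr_gt0. Qed.
Let sqc_gt0 : 0 < Num.sqrt c. Proof. by rewrite sqrtr_gt0. Qed.

Let K1_gt0 : 0 < K1.
Proof. by rewrite addr_gt0// divr_gt0 ?mulr_gt0 ?addr_gt0 ?divr_gt0 ?exprn_gt0// mulr_gt0. Qed.

Let kap_gt0 : 0 < kap.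
Proof. by rewrite !lt_min !invr_gt0 !divr_gt0 ?mulr_gt0 ?exprn_gt0. Qed.

(** * Arguments in the central range *)

Section central.
Variable x : R.
Hypothesis xD : `|x| * D <= kap * Num.sqrt r.
Hypothesis rD : K1 * D <= r.

Context (y : R).
Hypothesis yE : y = level x.

Let sqr1 : 1 <= Num.sqrt r.
Proof. by rewrite -[leLHS]sqrtr1 ler_wsqrtr. Qed.

Let xDr : `|x| * D <= kap * r.
Proof.
apply: le_trans xD _; rewrite ler_pM2l// -[leRHS](sqr_sqrtr (ltW r_gt0)) expr2.
by rewrite ler_peMr// ltW// (lt_le_trans _ sqr1).
Qed.

Let y_le : `|y| <= `|x| * Num.sqrt C / (c * r).
Proof.
rewrite yE /level normrM normfV normrM (gtr0_norm s0_gt0) (gtr0_norm (mulr_gt0 th_gt0 r_gt0)).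
apply: ler_pM; rewrite ?mulr_ge0 ?invr_ge0 ?(ltW s0_gt0) ?(ltW (mulr_gt0 th_gt0 r_gt0))//.
  by rewrite ler_wpM2l// s0E ler_wsqrtr// ltW//; have /andP[] := sigma2_cC.
rewrite lef_pV2 ?posrE ?mulr_gt0//; apply: ler_wpM2r; first exact: ltW.
by have /andP[/ltW] := theta_cC; rewrite -thE.
Qed.

Let Dy_le : D * `|y| <= kap * Num.sqrt C / c.
Proof.
apply: le_trans (_ : D * (`|x| * Num.sqrt C / (c * r)) <= _).
  by rewrite ler_wpM2l//; have := D_ge1; lra.
have -> : D * (`|x| * Num.sqrt C / (c * r)) = (`|x| * D) * (Num.sqrt C / c) / r.
  by field; rewrite !gt_eqF.
rewrite ler_pdivrMr//.
have -> : kap * Num.sqrt C / c * r = kap * r * (Num.sqrt C / c) by ring.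
by rewrite ler_pM2r// divr_gt0.
Qed.

Let y_eps : `|y| <= eps.
Proof.
apply: le_trans (_ : D * `|y| <= _); first by rewrite ler_peMl.
apply: (le_trans Dy_le); rewrite ler_pdivrMr// -ler_pdivlMr//.
by rewrite /kap ge_min lexx.
Qed.

Let V := pattern_var X y.
Context (s : R).
Hypothesis sE : s = Num.sqrt V / r.

Let V_dist : `|V - n%:R * sigma2 X| <= n%:R * D * (4 * (A * `|y|)).
Proof.
have -> : n%:R * sigma2 X = pattern_var X 0.
  by rewrite sigma2_pattern_var mulrA divff ?mul1r// pnatr_eq0 -lt0n.
apply: (pattern_var_lip dep N1_le) => i.
by have [_ _ ?] := regF i; exact: derivs_bounded_lip y_eps.
Qed.

(** The second entry of the minimum [kap] makes the change of variance at most half of the lower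
    bound [n * c]. *)
Let V_ge : n%:R * (c / 2) <= V.
Proof.
have h : n%:R * D * (4 * (A * `|y|)) <= n%:R * (c / 2).
  have -> : n%:R * D * (4 * (A * `|y|)) = n%:R * (4 * A * (D * `|y|)) by ring.
  rewrite ler_wpM2l//.
  apply: le_trans (_ : 4 * A * (kap * Num.sqrt C / c) <= _).
    by rewrite ler_wpM2l// mulr_ge0// ltW.
  have k : kap <= c ^+ 2 / (8 * A * Num.sqrt C).
    by rewrite /kap ge_min; apply/orP; right; rewrite ge_min lexx.
  have -> : c / 2 = 4 * A * ((c ^+ 2 / (8 * A * Num.sqrt C)) * Num.sqrt C / c).
    by field; rewrite !gt_eqF.
  rewrite ler_pM2l ?mulr_gt0// ler_pM2r ?invr_gt0// ler_pM2r//.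
have : n%:R * c <= n%:R * sigma2 X by rewrite ler_wpM2l// ltW//; have /andP[] := sigma2_cC.
by move: V_dist h; rewrite ler_norml; lra.
Qed.

Let V_gt0 : 0 < V.
Proof. by apply: lt_le_trans V_ge; rewrite mulr_gt0 ?ltr0n ?divr_gt0. Qed.

Let sV : Num.sqrt V = s * r.
Proof. by rewrite sE divfK// gt_eqF. Qed.

Let s2 : s ^+ 2 = V / n%:R.
Proof. by rewrite sE expr_div_n sqr_sqrtr ?r2// ltW. Qed.

Let s_ge : sc <= s.
Proof.
rewrite sE ler_pdivlMr// /sc rE -sqrtrM ?divr_ge0 ?(ltW c_gt0)//.
by rewrite ler_wsqrtr// mulrC.
Qed.

Let s_gt0 : 0 < s. Proof. exact: lt_le_trans sc_gt0 s_ge. Qed.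

Let sc_le_s0 : Num.sqrt c <= s0.
Proof. by rewrite s0E ler_wsqrtr// ltW//; have /andP[] := sigma2_cC. Qed.

(** Multiplying by [s0 + s], which is at least [Num.sqrt c], reduces the claim to the difference of
    variances. *)
Let s_dist : `|s0 - s| <= 4 * A * (D * `|y|) / Num.sqrt c.
Proof.
rewrite ler_pdivlMr//.
apply: le_trans (_ : `|s0 - s| * (s0 + s) <= _).
  by rewrite ler_wpM2l//; have := s_gt0; have := sc_le_s0; lra.
have -> : `|s0 - s| * (s0 + s) = `|s0 ^+ 2 - s ^+ 2|.
  by rewrite subr_sqr normrM (gtr0_norm (addr_gt0 s0_gt0 s_gt0)).
have n0 : 0 < n%:R :> R by rewrite ltr0n.
rewrite s02 s2 -(ler_pM2l n0).
have -> : n%:R * `|sigma2 X - V / n%:R| = `|V - n%:R * sigma2 X|.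
  rewrite -[X in X * _](gtr0_norm n0) -normrM distrC; congr `|_|.
  by field; rewrite gt_eqF.
rewrite [leRHS](_ : _ = n%:R * D * (4 * (A * `|y|))); [exact: V_dist|ring].
Qed.

(** The standardized level: the median's distribution function at [x] is approximated by
    [gauss_cdf w]. *)
Let w := (\sum_i rcdf (X i) y - n./2%:R) / Num.sqrt V.

Let w_dist : `|w - x| <= K1 * D * (1 + x ^+ 2) / r.
Proof.
pose rho := \sum_i (rcdf (X i) y - rcdf (X i) 0 - (rcdf (X i))^`()%classic 0 * y).
have F0 i : rcdf (X i) 0 = 2^-1 by have [h _ _] := regF i; apply/h.
have n0 : 0 < n%:R :> R by rewrite ltr0n.
have sumF : \sum_i rcdf (X i) y = n%:R / 2 + n%:R * th * y + rho.
  rewrite /rho !sumrB -mulr_suml (eq_bigr _ (fun i _ => F0 i)) sumr_const card_ord.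
  have -> : n%:R * th = \sum_i (rcdf (X i))^`()%classic 0.
    by rewrite thE /theta mulrA divff ?mul1r// gt_eqF.
  by rewrite -[2^-1 *+ n]mulr_natl; ring.
have rho_le : `|rho| <= n%:R * (A * y ^+ 2).
  apply: (le_trans (ler_norm_sum _ _ _)).
  rewrite -[leRHS](_ : \sum_(i < n) A * y ^+ 2 = _); last first.
    by rewrite sumr_const card_ord mulr_natl.
  apply: ler_sum => i _; have [_ _ ?] := regF i.
  exact: derivs_bounded_taylor y_eps.
have y2 : n%:R * y ^+ 2 <= x ^+ 2 * C / c ^+ 2.
  have -> : x ^+ 2 * C / c ^+ 2 = n%:R * (`|x| * Num.sqrt C / (c * r)) ^+ 2.
    rewrite expr_div_n !exprMn real_normK ?num_real// sqr_sqrtr ?(ltW C_gt0)// r2.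
    by field; rewrite !gt_eqF.
  rewrite ler_pM2l// -(real_normK (num_real y)) ler_pXn2r// ?nnegrE//.
  by rewrite divr_ge0 ?mulr_ge0// ltW.
have D1 := D_ge1; have x2 := sqr_ge0 x.
(* Since |y| is of order |x| / r, the first term is of order D x^2 / r by [s_dist], and the second
   of order (1 + x^2) / r by the bound on [rho] and the rounding error. *)
have -> : w - x = x * (s0 - s) / s + (rho + (n%:R / 2 - n./2%:R)) / (s * r).
  rewrite /w sumF sV.
  have -> : n%:R * th * y = r * s0 * x.
    by rewrite yE /level -r2; field; rewrite !gt_eqF.
  by field; rewrite !gt_eqF.
apply: (le_trans (ler_normD _ _)).
have -> : K1 * D * (1 + x ^+ 2) / r = 4 * A * Num.sqrt C / (c * Num.sqrt c * sc) * D * (1 + x ^+ 2) / r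
   + (A * C / c ^+ 2 + 1) / sc * D * (1 + x ^+ 2) / r by rewrite /K1; ring.
apply: lerD.
  rewrite normrM normfV (gtr0_norm s_gt0) normrM.
  apply: le_trans (_ : `|x| * (4 * A * (D * (`|x| * Num.sqrt C / (c * r))) / Num.sqrt c) / sc <= _).
    apply: ler_pM; rewrite ?mulr_ge0 ?invr_ge0 ?(ltW s_gt0)//; last first.
      by rewrite lef_pV2 ?posrE.
    rewrite ler_wpM2l//; apply: (le_trans s_dist); rewrite ler_pM2r ?invr_gt0//.
    by rewrite ler_wpM2l ?mulr_ge0 ?(ltW A_gt0)// ler_wpM2l//; lra.
  have -> : `|x| * (4 * A * (D * (`|x| * Num.sqrt C / (c * r))) / Num.sqrt c) / sc =
     4 * A * Num.sqrt C / (c * Num.sqrt c * sc) * D * x ^+ 2 / r.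
    rewrite -(real_normK (num_real x)); field; rewrite !gt_eqF//.
  rewrite ler_pM2r ?invr_gt0// ler_wpM2l//; last lra.
  by rewrite !mulr_ge0 ?invr_ge0 ?mulr_ge0//; try exact: ltW; lra.
rewrite normrM normfV (gtr0_norm (mulr_gt0 s_gt0 r_gt0)).
have -> : (A * C / c ^+ 2 + 1) / sc * D * (1 + x ^+ 2) / r =
   ((A * C / c ^+ 2 + 1) * D * (1 + x ^+ 2)) / (sc * r) by field; rewrite !gt_eqF.
apply: ler_pM; rewrite ?invr_ge0 ?mulr_ge0 ?(ltW s_gt0) ?(ltW r_gt0)//; last first.
  by rewrite lef_pV2 ?posrE ?mulr_gt0// ler_pM2r.
apply: (le_trans (ler_normD _ _)).
have q0 : 0 <= A * C / c ^+ 2 by rewrite divr_ge0 ?mulr_ge0 ?sqr_ge0// ltW.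
have q1 : n%:R * (A * y ^+ 2) <= A * C / c ^+ 2 * x ^+ 2.
  have -> : A * C / c ^+ 2 * x ^+ 2 = A * (x ^+ 2 * C / c ^+ 2) by ring.
  by rewrite mulrCA ler_pM2l.
have q2 : `|n%:R / 2 - n./2%:R| <= 1 :> R.
  by have := half_bounds R n; rewrite ler_norml; lra.
set q := A * C / c ^+ 2 in q0 q1 *.
have : (q + 1) * (1 + x ^+ 2) <= (q + 1) * D * (1 + x ^+ 2).
  by rewrite ler_wpM2r ?addr_ge0// ler_peMr// addr_ge0.
have : 0 <= q + x ^+ 2 by rewrite addr_ge0.
by move: q1 q2 rho_le; nra.
Qed.

Lemma median_cdf_central :
  `|median_cdf x - gauss_cdf x| <= (74 / sc ^+ 3 + 16 * K1) * (D ^+ 2 / r).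
Proof.
have D1 := D_ge1; have x2 := sqr_ge0 x.
have D0 : 0 < D by lra.
have BE := @pattern_berry_esseen _ _ _ _ _ X _ _ _ _ dep D0 N1_le N2_le y (- w) V_gt0.
have bE : n%:R * (Num.sqrt V)^-1 ^+ 3 * D ^+ 2 <= (sc ^+ 3)^-1 * (D ^+ 2 / r).
  rewrite sV; have -> : n%:R * (s * r)^-1 ^+ 3 * D ^+ 2 = (s ^+ 3)^-1 * (D ^+ 2 / r).
    by rewrite -r2; field; rewrite !gt_eqF.
  rewrite ler_wpM2r ?divr_ge0 ?sqr_ge0 ?(ltW r_gt0)//.
  by rewrite lef_pV2 ?posrE ?exprn_gt0// ler_pXn2r// nnegrE; apply: ltW.
(* This is the hypothesis of [gauss_cdf_dist]: the part of [w_dist] quadratic in [x] is absorbed by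
   [kap <= (2 * K1)^-1], the constant part by [rD]. *)
have wx1 : `|w - x| <= `|x| / 2 + 1.
  apply: (le_trans w_dist); rewrite mulrDr mulr1 mulrDl addrC; apply: lerD; last first.
    by rewrite ler_pdivrMr// mul1r.
  rewrite ler_pdivrMr// -(real_normK (num_real x)) expr2.
  have -> : K1 * D * (`|x| * `|x|) = K1 * `|x| * (`|x| * D) by ring.
  apply: le_trans (_ : K1 * `|x| * (kap * r) <= _).
    by rewrite ler_wpM2l// mulr_ge0// ltW.
  have -> : K1 * `|x| * (kap * r) = `|x| * r * (K1 * kap) by ring.
  have -> : `|x| / 2 * r = `|x| * r * 2^-1 by ring.
  rewrite ler_wpM2l ?mulr_ge0 ?(ltW r_gt0)//.
  have : kap <= (2 * K1)^-1.
    by rewrite /kap ge_min; apply/orP; right; rewrite ge_min lexx orbT.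
  have K1K : K1 * (2 * K1)^-1 = 2^-1 by field; rewrite gt_eqF.
  by move=> k; rewrite -K1K; apply: ler_wpM2l => //; exact: ltW.
have gx : `|gauss_cdf w - gauss_cdf x| <= 16 * K1 * (D ^+ 2 / r).
  have := gauss_cdf_dist wx1.
  have p : 0 < 1 + x ^+ 2 by lra.
  rewrite -ler_pdivlMr// => /le_trans; apply.
  rewrite ler_pdivrMr//; apply: le_trans (_ : 16 * (K1 * D * (1 + x ^+ 2) / r) <= _).
    by rewrite ler_pM2l.
  have -> : 16 * (K1 * D * (1 + x ^+ 2) / r) = D * (16 * K1 * (1 + x ^+ 2) / r) by ring.
  have -> : 16 * K1 * (D ^+ 2 / r) * (1 + x ^+ 2) = D ^+ 2 * (16 * K1 * (1 + x ^+ 2) / r) by ring.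
  rewrite ler_wpM2r// ?expr2 ?ler_peMr//; last lra.
  by rewrite divr_ge0 ?(ltW r_gt0)// mulr_ge0 ?mulr_ge0 ?(ltW K1_gt0) ?(ltW p).
have MC : median_cdf x - gauss_cdf w = - (Ex (pattern_law X y)
    (fun S => (\sum_i cindic X y i S <= - w * Num.sqrt V)%R%:R) - gauss_cdf (- w)).
  rewrite median_cdf_pattern gauss_cdfN.
  have -> : - w * Num.sqrt V = n./2%:R - \sum_i rcdf (X i) y.
    by rewrite /w mulNr divfK ?opprB// gt_eqF// sqrtr_gt0.
  by rewrite -yE; ring.
have -> : median_cdf x - gauss_cdf x =
  (median_cdf x - gauss_cdf w) + (gauss_cdf w - gauss_cdf x) by ring.
apply: (le_trans (ler_normD _ _)); rewrite mulrDl; apply: lerD => //.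
rewrite MC normrN; apply: (le_trans BE); by rewrite -[leRHS]mulrA ler_wpM2l.
Qed.

End central.

(** The three summands pay for the case [r < K1 * D], for the central range, and for the tails. *)
Definition median_const : R := K1 + (74 / sc ^+ 3 + 16 * K1) + 2 / kap ^+ 2.

Lemma median_cdf_dist x : `|median_cdf x - gauss_cdf x| <= median_const * (D ^+ 2 / r).
Proof.
have D1 := D_ge1; have Dr : 0 <= D ^+ 2 / r by rewrite divr_ge0 ?sqr_ge0// ltW.
have k2 : 0 <= 2 / kap ^+ 2 by rewrite divr_ge0 ?sqr_ge0.
have K2 : 0 <= 74 / sc ^+ 3 + 16 * K1.
  by rewrite addr_ge0 ?divr_ge0 ?exprn_ge0 ?mulr_ge0// ltW.
rewrite /median_const; set K' := 74 / _ + _ in K2 *; set q := D ^+ 2 / r in Dr *.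
set k3 := 2 / kap ^+ 2 in k2 *.
have -> : (K1 + K' + k3) * q = K1 * q + (K' * q + k3 * q) by ring.
(* If [r < K1 * D], then [K1 * q] is at least 1 because [D >= 1], and the bound is trivial. *)
have [rD|rD] := lerP (K1 * D) r; last first.
  apply: le_trans (_ : 1 <= _).
    by have := median_cdf01 x; have := gauss_cdf_le1 x; have := gauss_cdf_ge0 x;
      rewrite ler_norml; lra.
  apply: le_trans (_ : K1 * q <= _).
    rewrite /q mulrA ler_pdivlMr// mul1r; apply: (le_trans (ltW rD)).
    by rewrite ler_pM2l// expr2 ler_peMr//; lra.
  by rewrite lerDl addr_ge0// mulr_ge0.
(* The cut-off is the edge of the central range; there [2 / u ^+ 2] is [2 / kap ^+ 2] times
   [D ^+ 2 / r], the same order as the central error. *)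
have u0 : 0 < kap * Num.sqrt r / D by rewrite divr_gt0 ?mulr_gt0 ?sqrtr_gt0//; lra.
have := kolmogorov_tail u0 median_cdf_homo median_cdf01.
move=> /(_ (K' * q)) H.
apply: le_trans (H _ x) _ => [z zu|].
  by apply: median_cdf_central => //; rewrite -ler_pdivlMr//; lra.
have -> : 2 / (kap * Num.sqrt r / D) ^+ 2 = k3 * q.
  rewrite /k3 /q expr_div_n exprMn sqr_sqrtr ?(ltW r_gt0)//.
  by field; rewrite !gt_eqF//; lra.
by rewrite lerDr mulr_ge0// ltW.
Qed.

End median_berry_esseen.

Section max_neighborhoods.
Context (n : nat) (N1 : 'I_n -> {set 'I_n}) (N2 : 'I_n -> 'I_n -> {set 'I_n})
  (N3 : 'I_n -> 'I_n -> 'I_n -> {set 'I_n}).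

Lemma card_N1_le_Dmax i : (#|N1 i| <= Dmax N1 N2 N3)%N.
Proof.
apply: leq_trans (leq_maxl _ _).
exact: (leq_bigmax (F := fun i => #|N1 i|)).
Qed.

Lemma card_N2_le_Dmax i j : j \in N1 i -> (#|N2 i j| <= Dmax N1 N2 N3)%N.
Proof.
move=> jN; apply: leq_trans (leq_trans (leq_maxl _ _) (leq_maxr _ _)).
apply: leq_trans (leq_bigmax (F := fun i => \max_(j in N1 i) #|N2 i j|) i).
exact: (leq_bigmax_cond (F := fun j => #|N2 i j|)).
Qed.

End max_neighborhoods.

Theorem theorem1p5 (R : realType) (eps A c C : R)
    (heps : 0 < eps) (hA : 0 < A) (hc : 0 < c) (hcC : c < C) :
  exists K : R,
  forall (d : nat -> measure_display) (T : forall n, measurableType (d n))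
    (P : forall n, probability (T n) R)
    (X : forall n, 'I_n -> {RV (P n) >-> R})
    (N1 : forall n, 'I_n -> {set 'I_n})
    (N2 : forall n, 'I_n -> 'I_n -> {set 'I_n})
    (N3 : forall n, 'I_n -> 'I_n -> 'I_n -> {set 'I_n}),
  (forall n, (0 < n)%N ->
     [/\ (forall i : 'I_n, cdf_regularity eps A (rcdf (X n i))),
         dependency_neighborhoods (X n) (N1 n) (N2 n) (N3 n),
         c < sigma2 (X n) < C,
         c < theta (X n) < C
       & (Dmax (N1 n) (N2 n) (N3 n))%:R <= C * n%:R `^ (4^-1)]) ->
  forall (dZ : measure_display) (U : measurableType dZ) (Q : probability U R)
    (Z : {RV Q >-> R}), standard_normal Z ->
  forall n, (0 < n)%N ->
    dKS (P n) Q
      (fun t => theta (X n) * Num.sqrt n%:R / Num.sqrt (sigma2 (X n))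
                * sample_median (fun i => X n i t))
      Z
    <= K * ((D1 (N1 n))%:R * Num.sqrt (ln n%:R + (D1 (N1 n))%:R)
              * Num.sqrt (ln n%:R / n%:R)
            + (Dmax (N1 n) (N2 n) (N3 n))%:R ^+ 2 / Num.sqrt n%:R).
Proof.
exists (median_const eps A c C) => d T P X N1 N2 N3 H dZ U Q Z NZ n n0.
have [reg dep s2 th _] := H n n0.
have N1_le i : #|N1 n i|%:R <= (Dmax (N1 n) (N2 n) (N3 n))%:R :> R.
  by rewrite ler_nat card_N1_le_Dmax.
have N2_le i j : j \in N1 n i -> #|N2 n i j|%:R <= (Dmax (N1 n) (N2 n) (N3 n))%:R :> R.
  by move=> jN; rewrite ler_nat card_N2_le_Dmax.
have D1 : 1 <= (Dmax (N1 n) (N2 n) (N3 n))%:R :> R.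
  apply: le_trans (N1_le (Ordinal n0)); rewrite ler1n card_gt0.
  by apply/finset.set0Pn; exists (Ordinal n0); have [dep1 _ _] := dep; case: (dep1 (Ordinal n0)).
have main x := median_cdf_dist n0 dep D1 N1_le N2_le heps hA hc reg s2 th
  erefl erefl erefl x.
(* The constant times a positive number bounds an absolute value, so it is nonnegative. *)
have K0 : 0 <= median_const eps A c C.
  have q0 : 0 < (Dmax (N1 n) (N2 n) (N3 n))%:R ^+ 2 / Num.sqrt n%:R :> R.
    by rewrite divr_gt0 ?exprn_gt0 ?(lt_le_trans ltr01 D1)// sqrtr_gt0 ltr0n.
  by rewrite -(pmulr_lge0 _ q0); exact: le_trans (main 0).
apply: ge_sup; first by eexists; exists 0.
move=> _ [x _ <-].
have -> : fine (Q [set u | Z u <= x]) = gauss_cdf x.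
  rewrite gauss_cdf_normal_prob -NZ; last exact: measurable_itv.
  by rewrite /distribution /pushforward; congr (fine (Q _)).
(* The error obtained is the second summand of the rate, and the first summand is nonnegative. *)
apply: le_trans (main x) _; apply: ler_wpM2l => //; rewrite lerDr.
by rewrite !mulr_ge0.
Qed.
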